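(* Under the hypotheses of Theorem 5.1 as described below, assume in addition that $p\not\equiv0$ and $$\lambda\frac{L^3}{4}\Big[\frac{2b}{\pi}+\frac{b\pi^2}{4}\Big]\le1.$$ Then (P) has a unique positive solution in $\{u\in C^2[0,L]:0\le u\le\lambda\sin(\frac{\pi}{L}x),\ 0\ge u''\ge(\lambda\sin(\frac{\pi}{L}x))''\}$, and the iterative sequences starting from $y_0\equiv0$, from $y_0=\lambda\sin(\frac{\pi}{L}x)$, and from any initial function $u_0$ in this set all converge uniformly to this unique positive solution.
   Context: Hypotheses of Theorem 5.1: $L>0$, $a,b,c>0$, $p\in L^1[0,L]$ nonnegative, $\lambda>0$ with $p(x)\le[\lambda\pi^4/L^4+a\lambda\pi^2/L^2+2b\lambda^2\pi/L]\sin(\pi x/L)+2\lambda cL/\pi$ a.e. and $c+b\lambda\pi^2/L^2\le\frac{4(a+2b\lambda L/\pi)}{L^3}\sigma(\sqrt{a+2b\lambda L/\pi}\,L)$, where $\sigma(t):=\dfrac{3t^3}{6t\cosh t+6t-12\sinh t-t^3}$. (P) is $w''''-(a+b\int_0^L w)w''+c\int_0^L w=p$ a.e. in $(0,L)$, $w(0)=w(L)=w''(0)=w''(L)=0$, solutions in $W^{4,1}[0,L]$. With $M=a+2b\lambda L/\pi$, $N=c+b\lambda\pi^2/L^2$, the iteration is: $y_n\in W^{4,1}[0,L]$ is the unique solution of $y_n''''-My_n''+N\int_0^L y_n=p+b\,y_{n-1}''\int_0^L y_{n-1}-2b\lambda\frac{L}{\pi}y_{n-1}''+b\lambda\frac{\pi^2}{L^2}\int_0^L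 y_{n-1}$ with $y_n(0)=y_n(L)=y_n''(0)=y_n''(L)=0$. *)

(* Defs.v *)
From HB Require Import structures.
From mathcomp Require Import all_boot all_order all_algebra.
From mathcomp Require Import all_classical all_reals all_analysis.
Set Implicit Arguments. Unset Strict Implicit. Unset Printing Implicit Defensive.
Import Order.TTheory GRing.Theory Num.Theory.
Import numFieldNormedType.Exports.
Local Open Scope classical_set_scope.
Local Open Scope ring_scope.

Section Defs.
Variable R : realType.
Local Notation mu := (@lebesgue_measure R).

Definition coshR (t : R) : R := (expR t + expR (- t)) / 2.
Definition sinhR (t : R) : R := (expR t - expR (- t)) / 2.

Definition sigmaR (t : R) : R :=
  3 * t ^+ 3 / (6 * t * coshR t + 6 * t - 12 * sinhR t - t ^+ 3).

Definition d1 (f : R -> R) : R -> R := derive1 f.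
Definition d2 (f : R -> R) : R -> R := derive1 (derive1 f).
Definition d3 (f : R -> R) : R -> R := derive1 (derive1 (derive1 f)).

Definition intR (a b : R) (f : R -> R) : R := \int[mu]_(x in `[a, b]) f x.

(* C^2[0,L] functions, represented by (extensions to) C^2 functions R -> R *)
Definition C2 (w : R -> R) : Prop :=
  (forall x, derivable w x 1) /\ (forall x, derivable (d1 w) x 1) /\
  continuous (d2 w).

(* w is in W^{4,1}[0,L] with fourth (weak) derivative g in L^1[0,L]:
   w is C^3 (represented on all of R) and w''' is absolutely continuous on
   [0,L] with w'''(x) = w'''(0) + \int_0^x g. *)
Definition W41 (L : R) (w g : R -> R) : Prop :=
  (forall x, derivable w x 1) /\ (forall x, derivable (d1 w) x 1) /\
  (forall x, derivable (d2 w) x 1) /\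
  mu.-integrable `[0, L] (EFin \o g) /\
  (forall x, 0 <= x <= L -> d3 w x = d3 w 0 + intR 0 x g).

Definition nav_bc (L : R) (w : R -> R) : Prop :=
  w 0 = 0 /\ w L = 0 /\ d2 w 0 = 0 /\ d2 w L = 0.

Definition sol_P (L a b c : R) (p w : R -> R) : Prop :=
  exists g, W41 L w g /\
    (\forall x \ae mu, `]0, L[%classic x ->
        g x - (a + b * intR 0 L w) * d2 w x + c * intR 0 L w = p x) /\
    nav_bc L w.

(* y is the solution of the linear problem of the iteration, given the
   previous iterate z *)
Definition iter_step (L a b c lam : R) (p z y : R -> R) : Prop :=
  let M := a + 2 * b * lam * L / pi in
  let N := c + b * lam * pi ^+ 2 / L ^+ 2 in
  exists g, W41 L y g /\
    (\forall x \ae mu, `]0, L[%classic x ->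
        g x - M * d2 y x + N * intR 0 L y =
        p x + b * d2 z x * intR 0 L z - 2 * b * lam * (L / pi) * d2 z x
            + b * lam * (pi ^+ 2 / L ^+ 2) * intR 0 L z) /\
    nav_bc L y.

Definition iter_seq (L a b c lam : R) (p y0 : R -> R) (y : nat -> R -> R) :=
  y 0%N = y0 /\ forall n, iter_step L a b c lam p (y n) (y n.+1).

Definition phi (L lam : R) (x : R) : R := lam * sin (pi / L * x).

Definition setS (L lam : R) (u : R -> R) : Prop :=
  C2 u /\ forall x, 0 <= x <= L ->
    0 <= u x <= phi L lam x /\ d2 (phi L lam) x <= d2 u x <= 0.

Definition unif_cvg_on (L : R) (y : nat -> R -> R) (u : R -> R) : Prop :=
  forall eps : R, 0 < eps -> exists N : nat, forall n, (N <= n)%N ->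
    forall x, 0 <= x <= L -> `|y n x - u x| < eps.

End Defs.

(* Main.v *)
(** Writing [Lam = \int phi] and [kap = lam pi^2 / L^2], one step of the
    iteration solves [y'''' - M y'' + N \int y = h_z] with
    [h_z = p + b (\int z - Lam) z'' + b kap \int z].  The bound on [N] says
    exactly that the kernel of this linear operator has nonnegative slope at
    both ends; since the kernel is convex where it is nonnegative, a
    nonnegative load then gives [y'' <= 0 <= y].  For the order "[u <= v] and
    [u'' >= v'']" the load is increasing in [z] and the upper bound on [p]
    makes [phi] a supersolution, so the iterates from [0] increase, those from
    [phi] decrease, and all others lie in between.  The integrals of a monotone
    sequence converge to some [I]; a nonnegative concave function is controlled
    by its integral, so consecutive iterates become uniformly close, and
    [y_n - u], where [u] solves the problem with the nonlocal term frozen at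
    [I], satisfies [d'' = (a + b I) d + o(1)].  Hence [y_n -> u] uniformly,
    [\int u = I] and [u] solves (P).  Two solutions [v], [w] in the set with
    [\int v <= \int w] satisfy [w <= v] by the maximum principle, hence
    coincide.

    All equations are used in the once integrated form, where only the
    continuous function [\int_0^x p] appears. *)

Require Import Defs.
From HB Require Import structures.
From mathcomp Require Import all_boot all_order all_algebra.
From mathcomp Require Import all_classical all_reals all_analysis.
From mathcomp Require Import ring lra.
Set Implicit Arguments. Unset Strict Implicit. Unset Printing Implicit Defensive.
Import Order.TTheory GRing.Theory Num.Theory.
Import numFieldNormedType.Exports.
Local Open Scope classical_set_scope.
Local Open Scope ring_scope.

(** * Globally differentiable functions and their primitives *)

(** Two obstacles shape the argument. As [p] is only integrable, a nonnegative load can only be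
    expressed as monotonicity of its primitive, and the kernel is paired with that nondifferentiable
    primitive by a Stieltjes inequality. For a pole [x0], each branch [psi] of the kernel satisfies
    [psi'' = M psi + q x (L - x) / 2] with [q >= 0] and vanishes at its end of the interval. The
    slope at one end is most endangered when the pole approaches the opposite end; the sign
    condition obtained in that limit is the bound through [sigma]. The second obstacle is that
    consecutive iterates become close only uniformly, with no control on the difference of their
    second derivatives. The equation for [y_n - u] is therefore integrated twice, so that the error
    involves the difference of the iterates themselves. The resulting second-order equation then
    also gives convergence of the second derivatives, which is how the limit inherits the bounds on
    [u'']. *)

Definition is_deriv {R : realType} (f f' : R -> R) : Prop :=
  forall x : R, is_derive x 1 f (f' x).

Lemma is_deriv_ext {R : realType} (f f' g : R -> R) :
  is_deriv f f' -> f' =1 g -> is_deriv f g.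
Proof. by move=> ff' e x; rewrite -e. Qed.

Lemma is_deriv_congr {R : realType} (f f' g g' : R -> R) :
  is_deriv f f' -> f =1 g -> f' =1 g' -> is_deriv g g'.
Proof. by move=> ff' /funext <- /funext <-. Qed.

Lemma is_derivD {R : realType} (f f' g g' : R -> R) :
  is_deriv f f' -> is_deriv g g' ->
  is_deriv (fun x => f x + g x) (fun x => f' x + g' x).
Proof. by move=> ff' gg' x; exact: is_deriveD. Qed.

Lemma is_derivN {R : realType} (f f' : R -> R) :
  is_deriv f f' -> is_deriv (fun x => - f x) (fun x => - f' x).
Proof. by move=> ff' x; exact: is_deriveN. Qed.

Lemma is_derivB {R : realType} (f f' g g' : R -> R) :
  is_deriv f f' -> is_deriv g g' ->
  is_deriv (fun x => f x - g x) (fun x => f' x - g' x).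
Proof. by move=> ff' gg' x; exact: is_deriveB. Qed.

Lemma is_deriv_cst {R : realType} (c : R) : is_deriv (fun=> c) (fun=> 0).
Proof. by move=> x; exact: is_derive_cst. Qed.

Lemma is_deriv_id {R : realType} : @is_deriv R (fun x => x) (fun=> 1).
Proof. by move=> x; exact: is_derive_id. Qed.

Lemma is_derivM {R : realType} (f f' g g' : R -> R) :
  is_deriv f f' -> is_deriv g g' ->
  is_deriv (fun x => f x * g x) (fun x => f' x * g x + f x * g' x).
Proof.
move=> ff' gg' x; apply: is_derive_eq (is_deriveM (ff' x) (gg' x)) _.
by rewrite /GRing.scale /= addrC mulrC [f x * _]mulrC [g' x * _]mulrC.
Qed.

Lemma is_derivZ {R : realType} (k : R) (f f' : R -> R) :
  is_deriv f f' -> is_deriv (fun x => k * f x) (fun x => k * f' x).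
Proof. by move=> ff' x; exact: is_deriveZ. Qed.

Lemma is_deriv_comp {R : realType} (f f' g g' : R -> R) :
  is_deriv f f' -> is_deriv g g' ->
  is_deriv (fun x => f (g x)) (fun x => f' (g x) * g' x).
Proof. by move=> ff' gg' x; exact: is_derive1_comp. Qed.

Lemma is_deriv_d1 {R : realType} (f f' : R -> R) : is_deriv f f' -> d1 f = f'.
Proof.
move=> ff'; apply/funext => x; rewrite /d1 derive1E.
by have [_ ->] := ff' x.
Qed.

Lemma is_deriv_derivable {R : realType} (f f' : R -> R) x :
  is_deriv f f' -> derivable f x 1.
Proof. by move=> ff'; have [] := ff' x. Qed.

Lemma derivable_is_deriv {R : realType} (f : R -> R) :
  (forall x, derivable f x 1) -> is_deriv f (d1 f).
Proof. by move=> df x; rewrite /d1 derive1E; exact/derivableP. Qed.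

Lemma is_deriv_continuous {R : realType} (f f' : R -> R) :
  is_deriv f f' -> continuous f.
Proof.
move=> ff' x; apply: differentiable_continuous.
by apply/derivable1_diffP; exact: is_deriv_derivable ff'.
Qed.

Lemma is_deriv_within {R : realType} (f f' : R -> R) (A : set R) :
  is_deriv f f' -> {within A, continuous f}.
Proof.
by move=> ff'; exact/continuous_subspaceT/(is_deriv_continuous ff').
Qed.

Lemma is_deriv_MVT {R : realType} (f f' : R -> R) (a b : R) :
  is_deriv f f' -> a < b ->
  exists2 c, a < c < b & f b - f a = f' c * (b - a).
Proof.
move=> ff' ab.
have [c] := MVT ab (fun x _ => ff' x) (is_deriv_within (A := `[a, b]) ff').
by rewrite in_itv /= => cab ->; exists c.
Qed.

Lemma is_deriv_nondecr {R : realType} (f f' : R -> R) (a b : R) :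
  is_deriv f f' -> (forall x, a <= x <= b -> 0 <= f' x) ->
  forall x y, a <= x -> x <= y -> y <= b -> f x <= f y.
Proof.
move=> ff' f'0 x y ax; rewrite le_eqVlt => /predU1P[->//|xy yb].
have [z /andP[xz zy] e] := is_deriv_MVT ff' xy.
rewrite -subr_ge0 e mulr_ge0 ?subr_ge0 ?(ltW xy) //.
by apply: f'0; rewrite (le_trans ax (ltW xz)) (le_trans (ltW zy) yb).
Qed.

Lemma is_deriv_nonincr {R : realType} (f f' : R -> R) (a b : R) :
  is_deriv f f' -> (forall x, a <= x <= b -> f' x <= 0) ->
  forall x y, a <= x -> x <= y -> y <= b -> f y <= f x.
Proof.
move=> ff' f'0 x y ax xy yb; rewrite -lerN2.
apply: (is_deriv_nondecr (is_derivN ff') _ ax xy yb) => z zab.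
by rewrite oppr_ge0 f'0.
Qed.

Lemma is_deriv_eq0 {R : realType} (f f' : R -> R) (a b : R) :
  is_deriv f f' -> (forall x, a <= x <= b -> f' x = 0) ->
  forall x, a <= x <= b -> f x = f a.
Proof.
move=> ff' f'0 x /andP[ax xb]; apply/le_anti/andP; split.
- by apply: (is_deriv_nonincr ff' _ (lexx a) ax xb) => z /f'0 ->.
- by apply: (is_deriv_nondecr ff' _ (lexx a) ax xb) => z /f'0 ->.
Qed.

(** The derivative is determined by increments that stay inside the interval, where [f] vanishes:
    negative ones at [b], positive ones at all other points. *)
Lemma is_deriv_zero {R : realType} (f f' : R -> R) (a b : R) :
  a < b -> is_deriv f f' -> (forall x, a <= x <= b -> f x = 0) ->
  forall x, a <= x <= b -> f' x = 0.
Proof.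
move=> ab ff' f0 x xab; have fx0 := f0 x xab.
have [df dfE] := ff' x; apply/eqP; rewrite -normr_le0; apply/ler_addgt0Pl => e e0.
rewrite addr0.
have : (fun h : R => h^-1 *: (f (h *: 1 + x) - f x)) @ 0^' --> f' x.
  by rewrite -dfE; exact: df.
move/cvgrPdist_lt => /(_ e e0) [d /= d0 hd].
have [h [hd' h0 hab]] : exists h : R, [/\ `|h| < d, h != 0 & a <= h + x <= b].
  case/andP: xab => ax; rewrite le_eqVlt => /predU1P[->|xb].
  - have k0 : 0 < Num.min (d / 2) (b - a) by rewrite lt_min; apply/andP; lra.
    have kd : Num.min (d / 2) (b - a) <= d / 2 by rewrite ge_min lexx.
    have ka : Num.min (d / 2) (b - a) <= b - a by rewrite ge_min lexx orbT.
    exists (- Num.min (d / 2) (b - a)).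
    by rewrite normrN gtr0_norm // oppr_eq0 (lt0r_neq0 k0); split=> //; lra.
  - have k0 : 0 < Num.min (d / 2) (b - x) by rewrite lt_min; apply/andP; lra.
    have kd : Num.min (d / 2) (b - x) <= d / 2 by rewrite ge_min lexx.
    have kb : Num.min (d / 2) (b - x) <= b - x by rewrite ge_min lexx orbT.
    exists (Num.min (d / 2) (b - x)).
    by rewrite gtr0_norm // (lt0r_neq0 k0); split=> //; lra.
have := hd h; rewrite /ball_ /= sub0r normrN => /(_ hd' h0).
rewrite /GRing.scale /= mulr1 (f0 _ hab) fx0 subrr mulr0 subr0.
exact: ltW.
Qed.

Lemma continuous_compose {R : realType} (f g : R -> R) :
  continuous f -> continuous g -> continuous (fun x => g (f x)).
Proof. by move=> cf cg x; exact: (continuous_comp (cf x) (cg (f x))). Qed.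

Lemma continuous_lincomb {R : realType} (k l : R) (f g : R -> R) :
  continuous f -> continuous g -> continuous (fun x => k * f x + l * g x).
Proof.
by move=> cf cg x; apply: cvgD; apply: cvgMr; [exact: cf|exact: cg].
Qed.

Lemma continuous_subc {R : realType} (c : R) (f : R -> R) :
  continuous f -> continuous (fun x => f x - c).
Proof. by move=> cf x; apply: cvgB; [exact: cf|exact: cvg_cst]. Qed.

(** Vanishing on the negative half-line makes [f] integrable on every left ray, so the integral from
    minus infinity is differentiable at all points, with no base point to choose. *)
Lemma antiderivative_exists_pos {R : realType} (f : R -> R) :
  continuous f -> (forall x, x <= 0 -> f x = 0) -> exists F, is_deriv F f.
Proof.
move=> cf f0; pose mu := @lebesgue_measure R.
exists (fun x => \int[mu]_(t in `]-oo, x]) f t) => x.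
have fi : mu.-integrable `]-oo, x + 1] (EFin \o f).
  have : mu.-integrable `[0, x + 1] (EFin \o f).
    apply: continuous_compact_integrable; first exact: segment_compact.
    exact: continuous_subspaceT.
  rewrite integrable_mkcond // [X in _ -> X]integrable_mkcond //.
  congr (integrable _ _ _).
  apply/funext => t; rewrite /patch !mem_setE !in_itv /=.
  by case: (leP 0 t) => //= /ltW/f0 ->; case: ifP.
have x1 : x < x + 1 by rewrite ltrDl.
have [|dF F'] := continuous_FTC1 x1 fi _ (cf x); first by rewrite ltNyr.
apply: DeriveDef; first exact: dF.
by rewrite -derive1E; exact: F'.
Qed.

(** The right half of [f - f 0] and the reflected left half both vanish on the negative half-line
    and have antiderivatives; the constant [f 0] returns as a linear term. *)
Lemma antiderivative_exists {R : realType} (f : R -> R) :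
  continuous f -> exists F, is_deriv F f.
Proof.
move=> cf.
have cmax : continuous (fun x : R => Num.max x 0).
  by move=> x; apply: continuous_max; [exact: cvg_id | exact: cvg_cst].
have cNmax : continuous (fun x : R => - Num.max x 0).
  by move=> x; apply: cvgN; exact: cmax.
have [F1 hF1] : exists F, is_deriv F (fun x => f (Num.max x 0) - f 0).
  apply: antiderivative_exists_pos => [x|x x0].
    exact/continuous_subc/continuous_compose.
  by rewrite (max_idPr x0) subrr.
have [F2 hF2] : exists F, is_deriv F (fun x => f (- Num.max x 0) - f 0).
  apply: antiderivative_exists_pos => [x|x x0].
    exact/continuous_subc/(continuous_compose cNmax).
  by rewrite (max_idPr x0) oppr0 subrr.
exists (fun x => F1 x - F2 (- x) + f 0 * x).
apply: is_deriv_ext.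
  apply: is_derivD; last exact: (is_derivZ (f 0) is_deriv_id).
  apply: (is_derivB hF1); exact: (is_deriv_comp hF2 (is_derivN is_deriv_id)).
move=> x /=; case: (leP 0 x) => x0.
- rewrite (_ : Num.max (- x) 0 = 0); last by apply/max_idPr; rewrite oppr_le0.
  by rewrite oppr0 subrr; ring.
- rewrite (_ : Num.max (- x) 0 = - x); last by apply/max_idPl; rewrite oppr_ge0 ltW.
  by rewrite opprK; ring.
Qed.

Lemma intR_FTC {R : realType} (F f : R -> R) (a b : R) :
  a <= b -> is_deriv F f -> continuous f -> intR a b f = F b - F a.
Proof.
rewrite le_eqVlt => /predU1P[->|ab] Ff cf.
  by rewrite /intR set_itv1 Rintegral_set1 subrr.
rewrite /intR /Rintegral (continuous_FTC2 ab _ _ _ (F := F)) //.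
- exact: continuous_subspaceT.
- split; [by move=> x _; exact: is_deriv_derivable Ff| |].
  + exact/cvg_at_right_filter/(is_deriv_continuous Ff).
  + exact/cvg_at_left_filter/(is_deriv_continuous Ff).
- by move=> x _; rewrite -[LHS]/(d1 F x) (is_deriv_d1 Ff).
Qed.

Lemma intR_lincomb {R : realType} (a b k l : R) (f g : R -> R) :
  a <= b -> continuous f -> continuous g ->
  intR a b (fun x => k * f x + l * g x) = k * intR a b f + l * intR a b g.
Proof.
move=> ab cf cg; have [F hF] := antiderivative_exists cf.
have [G hG] := antiderivative_exists cg.
rewrite (intR_FTC ab hF cf) (intR_FTC ab hG cg).
rewrite (intR_FTC ab (is_derivD (is_derivZ k hF) (is_derivZ l hG))); first ring.
exact: continuous_lincomb.
Qed.

Lemma intR_le {R : realType} (a b : R) (f g : R -> R) :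
  a <= b -> continuous f -> continuous g ->
  (forall x, a <= x <= b -> f x <= g x) -> intR a b f <= intR a b g.
Proof.
move=> ab cf cg fg; have [F hF] := antiderivative_exists cf.
have [G hG] := antiderivative_exists cg.
rewrite (intR_FTC ab hF cf) (intR_FTC ab hG cg).
have := is_deriv_nondecr (is_derivB hG hF) _ (lexx a) ab (lexx b).
have h x : a <= x <= b -> 0 <= g x - f x by move=> ?; rewrite subr_ge0 fg.
by move=> /(_ h); rewrite /=; lra.
Qed.

(** * Hyperbolic functions and Stieltjes integration by parts *)

Lemma is_deriv_coshR {R : realType} : is_deriv (@coshR R) (@sinhR R).
Proof.
have h := is_deriv_comp (fun x => is_derive_expR x) (is_derivN (@is_deriv_id R)).
have -> : @coshR R = (fun x => 2^-1 * (expR x + expR (- x))).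
  by apply/funext => x; rewrite /coshR mulrC.
apply: is_deriv_ext (is_derivZ _ (is_derivD (fun x => is_derive_expR x) h)) _.
by move=> x; rewrite /sinhR /=; ring.
Qed.

Lemma is_deriv_sinhR {R : realType} : is_deriv (@sinhR R) (@coshR R).
Proof.
have h := is_deriv_comp (fun x => is_derive_expR x) (is_derivN (@is_deriv_id R)).
have -> : @sinhR R = (fun x => 2^-1 * (expR x - expR (- x))).
  by apply/funext => x; rewrite /sinhR mulrC.
apply: is_deriv_ext (is_derivZ _ (is_derivB (fun x => is_derive_expR x) h)) _.
by move=> x; rewrite /coshR /=; ring.
Qed.

Lemma coshR0 {R : realType} : @coshR R 0 = 1.
Proof. by rewrite /coshR oppr0 expR0; field. Qed.

Lemma sinhR0 {R : realType} : @sinhR R 0 = 0.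
Proof. by rewrite /sinhR oppr0 expR0; field. Qed.

Lemma coshRB {R : realType} (x y : R) :
  coshR (x - y) = coshR x * coshR y - sinhR x * sinhR y.
Proof. by rewrite /coshR /sinhR opprB !expRD; field. Qed.

Lemma sinhRB {R : realType} (x y : R) :
  sinhR (x - y) = sinhR x * coshR y - coshR x * sinhR y.
Proof. by rewrite /coshR /sinhR opprB !expRD; field. Qed.

Lemma coshR_sq {R : realType} (x : R) : coshR x ^+ 2 = 1 + sinhR x ^+ 2.
Proof.
have := coshRB x x; rewrite subrr coshR0 !expr2 => ->; ring.
Qed.

Lemma coshR_gt0 {R : realType} (x : R) : 0 < coshR x.
Proof. by rewrite divr_gt0 ?addr_gt0 ?expR_gt0. Qed.

Lemma coshR_ge1 {R : realType} (x : R) : 1 <= coshR x.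
Proof.
have := coshR_sq x; have := coshR_gt0 x.
by move: (coshR x) (sinhR x) => c s; nra.
Qed.

Lemma sinhR_gt0 {R : realType} (x : R) : 0 < x -> 0 < sinhR x.
Proof. by move=> x0; rewrite divr_gt0 // subr_gt0 ltr_expR; lra. Qed.

Lemma sinhR_ge0 {R : realType} (x : R) : 0 <= x -> 0 <= sinhR x.
Proof. by move=> x0; rewrite divr_ge0 // subr_ge0 ler_expR; lra. Qed.

Lemma is_deriv_coshM {R : realType} (m : R) :
  is_deriv (fun x => coshR (m * x)) (fun x => m * sinhR (m * x)).
Proof.
apply: is_deriv_ext.
  exact: (is_deriv_comp is_deriv_coshR (is_derivZ m is_deriv_id)).
by move=> x /=; ring.
Qed.

Lemma is_deriv_sinhM {R : realType} (m : R) :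
  is_deriv (fun x => sinhR (m * x)) (fun x => m * coshR (m * x)).
Proof.
apply: is_deriv_ext.
  exact: (is_deriv_comp is_deriv_sinhR (is_derivZ m is_deriv_id)).
by move=> x /=; ring.
Qed.

Lemma sinhR_lt_mul_coshR {R : realType} (t : R) :
  0 < t -> sinhR t < t * coshR t.
Proof.
move=> t0.
have h := is_derivB (is_derivM is_deriv_id is_deriv_coshR) (@is_deriv_sinhR R).
have [c /andP[c0 ct] /=] := is_deriv_MVT h t0.
rewrite sinhR0 mul0r !subr0 -subr_gt0 => ->.
by rewrite mulr_gt0 // mul1r addrAC subrr add0r mulr_gt0 // sinhR_gt0.
Qed.

(** The derivative of the difference is [t cosh t - sinh t]. In the form [tanh (t / 2) < t / 2],
    this makes the slope of [ker_k] at the origin positive. *)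
Lemma coshR_lt_mul_sinhR {R : realType} (t : R) :
  0 < t -> 2 * (coshR t - 1) < t * sinhR t.
Proof.
move=> t0.
have h := is_derivB (is_derivM is_deriv_id is_deriv_sinhR)
  (is_derivZ 2 (is_derivB (@is_deriv_coshR R) (is_deriv_cst 1))).
have [c /andP[c0 ct] /=] := is_deriv_MVT h t0.
rewrite coshR0 mul0r !subrr mulr0 !subr0 -subr_gt0 => ->.
have := sinhR_lt_mul_coshR c0 => sc.
by rewrite mulr_gt0 //; lra.
Qed.

(* The solution of [f'' = M f + r] factors through two first-order problems:
   [e^{-mx} (f' + m f)] and then [e^{mx} f] are nondecreasing. *)
Lemma second_order_ge0 {R : realType} (m b : R) (f f1 r : R -> R) :
  is_deriv f f1 -> is_deriv f1 (fun x => m ^+ 2 * f x + r x) ->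
  (forall x : R, 0 <= x <= b -> 0 <= r x) -> f 0 = 0 -> 0 <= f1 0 ->
  forall x : R, 0 <= x <= b -> 0 <= f x.
Proof.
move=> ff1 ff2 r0 f00 f10 x /andP[x0 xb].
have de (k : R) : is_deriv (fun x => expR (k * x)) (fun x => k * expR (k * x)).
  apply: is_deriv_ext.
    exact: (is_deriv_comp (fun x => is_derive_expR x) (is_derivZ k is_deriv_id)).
  by move=> z /=; ring.
have h1 z : 0 <= z <= b -> 0 <= f1 z + m * f z.
  move=> /andP[z0 zb].
  have h := is_derivM (de (- m)) (is_derivD ff2 (is_derivZ m ff1)).
  have := is_deriv_nondecr h _ (lexx 0) z0 zb.
  rewrite mulr0 expR0 f00 mulr0 addr0 mul1r => H.
  rewrite -(pmulr_rge0 _ (expR_gt0 (- m * z))); apply: le_trans f10 (H _) => s sb.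
  have := r0 s sb; have := expR_gt0 (- m * s).
  move: (expR _) (r s) (f s) (f1 s) => e r' f' f1' e0 r'0.
  rewrite (_ : _ + _ = e * r'); last by ring.
  by rewrite mulr_ge0 // ltW.
have := is_deriv_nondecr (is_derivM (de m) ff1) _ (lexx 0) x0 xb.
rewrite f00 mulr0 => H; rewrite -(pmulr_rge0 _ (expR_gt0 (m * x))).
apply: H => s sb; have := h1 s sb; have := expR_gt0 (m * s).
move: (expR _) (f s) (f1 s) => e f' f1' e0 h.
rewrite (_ : _ + _ = e * (f1' + m * f')); last by ring.
by rewrite mulr_ge0 // ltW.
Qed.

(* If [E] were differentiable this would be [(psi E - Theta)' = psi E' >= 0].
   The mean value theorem bounds the defect on an interval by its length times
   the increment of [E], and repeated bisection makes that arbitrarily small. *)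
Lemma stieltjes_by_parts_le {R : realType} (psi psi1 psi2 Theta E : R -> R)
    (a b : R) :
  a <= b -> is_deriv psi psi1 -> is_deriv psi1 psi2 ->
  is_deriv Theta (fun x => psi1 x * E x) ->
  (forall x : R, a <= x <= b -> 0 <= psi x) ->
  (forall x y : R, a <= x -> x <= y -> y <= b -> E x <= E y) ->
  Theta b - Theta a <= psi b * E b - psi a * E a.
Proof.
move=> ab h1 h2 hT psi0 Em.
have [B B0 hB] : exists2 B, 0 <= B & forall x : R, a <= x <= b -> `|psi1 x| <= B.
  have cn : {within `[a, b], continuous (fun x => `|psi1 x|)}.
    apply: continuous_subspaceT => x; apply: cvg_norm.
    exact: (is_deriv_continuous h2).
  have [c _ hc] := EVT_max ab cn.
  by exists `|psi1 c| => // x xab; apply: hc; rewrite in_itv.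
pose F x := psi x * E x - Theta x.
suff : F a <= F b by rewrite /F; lra.
(* Bisection halves the length while the increments of [E] over the two halves add up, so the total
   defect is divided by two at each level; [2 ^+ n] records this without a division. *)
have key n : forall s t : R, a <= s -> s <= t -> t <= b ->
    0 <= (F t - F s) * 2 ^+ n + B * (E t - E s) * (t - s).
  elim: n => [|n IH] s t as_ st tb.
    rewrite expr0 mulr1; move: st; rewrite le_eqVlt => /predU1P[->|st].
      by rewrite !subrr mulr0 addr0.
    have [c /andP[sc ct]] := is_deriv_MVT (is_derivB (is_derivZ (E s) h1) hT) st.
    have ec : E s <= E c by apply: Em; lra.
    have et : E c <= E t by apply: Em; lra.
    have pt : 0 <= psi t by apply: psi0; lra.
    have pc : `|psi1 c| <= B by apply: hB; lra.
    rewrite /F; move: (psi s) (psi t) (Theta s) (Theta t) pt => ps pt Ts Tt pt0 e.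
    have -> : pt * E t - Tt - (ps * E s - Ts) + B * (E t - E s) * (t - s) =
      pt * (E t - E s) + (B * (E t - E s) - psi1 c * (E c - E s)) * (t - s).
      have -> : Tt = E s * pt - E s * ps + Ts -
        (E s * psi1 c - psi1 c * E c) * (t - s) by rewrite -e; ring.
      ring.
    apply: addr_ge0; first by apply: mulr_ge0 => //; lra.
    apply: mulr_ge0; last lra.
    rewrite subr_ge0; apply: le_trans (ler_norm _) _; rewrite normrM.
    rewrite [X in _ * X]ger0_norm ?subr_ge0 //.
    by apply: ler_pM; rewrite ?subr_ge0 ?lerD2r.
  pose u := (s + t) / 2.
  have su : s <= u by rewrite /u; lra.
  have ut : u <= t by rewrite /u; lra.
  have h1' := IH s u as_ su (le_trans ut tb).
  have h2' := IH u t (le_trans as_ su) ut tb.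
  rewrite exprS.
  have -> : (F t - F s) * (2 * 2 ^+ n) + B * (E t - E s) * (t - s) =
    2 * ((F u - F s) * 2 ^+ n + B * (E u - E s) * (u - s) +
         ((F t - F u) * 2 ^+ n + B * (E t - E u) * (t - u))).
    by rewrite /u; field.
  by rewrite mulr_ge0 // addr_ge0.
rewrite leNgt; apply/negP => FF.
set K := B * (E b - E a) * (b - a) in key.
have d0 : 0 < F a - F b by rewrite subr_gt0.
pose n := Num.bound (B * (E b - E a) * (b - a) / (F a - F b)).
have K0 : 0 <= B * (E b - E a) * (b - a) / (F a - F b).
  rewrite divr_ge0 ?(ltW d0) // !mulr_ge0 // subr_ge0 //.
  exact: Em.
have := archi_boundP K0; rewrite -/n ltr_pdivrMr // => Kn.
have := key n a b (lexx a) ab (lexx b).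
have : n%:R <= 2 ^+ n :> R by rewrite -natrX ler_nat ltnW // ltn_expl.
rewrite -subr_ge0 => /mulr_ge0 /(_ (ltW d0)).
rewrite /K; move: (B * _ * _) (2 ^+ n) Kn => k P; lra.
Qed.

(** * The kernel of the linear problem and the maximum principle *)

Lemma is_deriv_bump {R : realType} (L : R) :
  is_deriv (fun x => x * (L - x) / 2) (fun x => L / 2 - x).
Proof.
have h := is_derivZ 2^-1 (is_derivM is_deriv_id
  (is_derivB (is_deriv_cst L) (@is_deriv_id R))).
have -> : (fun x => x * (L - x) / 2) = (fun x => 2^-1 * (x * (L - x))).
  by apply/funext => x; rewrite mulrC.
by apply: is_deriv_ext h _ => x /=; field.
Qed.

(** A primitive of [psi1 x * (y3 x - M * y1 x + K * x)] when [psi'' = M psi + q x (L - x) / 2],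
    where [Yp] and [Psi] are primitives of [y] and [psi]. *)
Definition green_form {R : realType} (y y1 y2 Yp psi psi1 Psi : R -> R)
    (M K q L x : R) : R :=
  psi1 x * y2 x - (M * psi x + q * (x * (L - x) / 2)) * y1 x
  - q * ((x - L / 2) * y x - Yp x) + K * (x * psi x - Psi x).

(* Green's identity for [y'''' - M y''] against [psi] on [a, b], with
   [y3 x - M y1 x + K x] playing the role of the primitive of the load. *)
Lemma green_le {R : realType} (y y1 y2 y3 Yp psi psi1 Psi : R -> R)
    (M K q L a b : R) :
  is_deriv y y1 -> is_deriv y1 y2 -> is_deriv y2 y3 -> is_deriv Yp y ->
  is_deriv Psi psi -> is_deriv psi psi1 ->
  is_deriv psi1 (fun s => M * psi s + q * (s * (L - s) / 2)) ->
  a <= b -> (forall x : R, a <= x <= b -> 0 <= psi x) ->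
  (forall s t : R, a <= s -> s <= t -> t <= b ->
     y3 s - M * y1 s + K * s <= y3 t - M * y1 t + K * t) ->
  green_form y y1 y2 Yp psi psi1 Psi M K q L b
  - green_form y y1 y2 Yp psi psi1 Psi M K q L a
  <= psi b * (y3 b - M * y1 b + K * b) - psi a * (y3 a - M * y1 a + K * a).
Proof.
move=> hy hy1 hy2 hY hPsi hpsi hpsi1 ab psi0 Em.
apply: (stieltjes_by_parts_le ab hpsi hpsi1 _ psi0 Em).
have hb := is_derivD (is_derivZ M hpsi) (is_derivZ q (is_deriv_bump L)).
have hl := is_derivM (is_derivB is_deriv_id (is_deriv_cst (L / 2))) hy.
have := is_derivD (is_derivB (is_derivB (is_derivM hpsi1 hy2)
  (is_derivM hb hy1)) (is_derivZ q (is_derivB hl hY)))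
  (is_derivZ K (is_derivB (is_derivM is_deriv_id hpsi) hPsi)).
by move=> h; apply: is_deriv_ext h _ => x /=; field.
Qed.

Section Kernels.
Variables (R : realType) (m L : R).
Let t : R := m * L.
(** This is [tanh (t / 2)], the value for which [ker_g] vanishes at [L]. *)
Let tau : R := (coshR t - 1) / sinhR t.

(* The solution of [- g'' + m^2 g = 1], [g(0) = g(L) = 0]. *)
Definition ker_g (x : R) : R :=
  (1 - coshR (m * x) + tau * sinhR (m * x)) / m ^+ 2.
Definition ker_g1 (x : R) : R := (tau * coshR (m * x) - sinhR (m * x)) / m.
Definition ker_G (x : R) : R :=
  (x - sinhR (m * x) / m + tau * (coshR (m * x) / m)) / m ^+ 2.

(* The solution of [- k'' + m^2 k = x (L - x) / 2], [k(0) = k(L) = 0]. *)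
Definition ker_k (x : R) : R := (x * (L - x) / 2 - ker_g x) / m ^+ 2.
Definition ker_k1 (x : R) : R := (L / 2 - x - ker_g1 x) / m ^+ 2.
Definition ker_K (x : R) : R :=
  (L * x ^+ 2 / 4 - x ^+ 3 / 6 - ker_G x) / m ^+ 2.

Hypothesis m0 : 0 < m.
Hypothesis L0 : 0 < L.
Let mN0 : m != 0. Proof. exact: lt0r_neq0. Qed.
Let t0 : 0 < t. Proof. exact: mulr_gt0. Qed.
Let sh0 : 0 < sinhR t. Proof. exact: sinhR_gt0. Qed.
Let shN0 : sinhR t != 0. Proof. exact: lt0r_neq0. Qed.

Lemma is_deriv_ker_G : is_deriv ker_G ker_g.
Proof.
have h := is_derivZ (m ^- 2) (is_derivD (is_derivB is_deriv_id
  (is_derivZ m^-1 (is_deriv_sinhM m))) (is_derivZ (tau / m) (is_deriv_coshM m))).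
by apply: (is_deriv_congr h) => x /=; rewrite /ker_G /ker_g; field.
Qed.

Lemma is_deriv_ker_g : is_deriv ker_g ker_g1.
Proof.
have h := is_derivZ (m ^- 2) (is_derivD (is_derivB (is_deriv_cst 1)
  (is_deriv_coshM m)) (is_derivZ tau (is_deriv_sinhM m))).
by apply: (is_deriv_congr h) => x /=; rewrite /ker_g /ker_g1; field.
Qed.

Lemma is_deriv_ker_g1 : is_deriv ker_g1 (fun x => m ^+ 2 * ker_g x - 1).
Proof.
have h := is_derivZ m^-1 (is_derivB (is_derivZ tau (is_deriv_coshM m))
  (is_deriv_sinhM m)).
by apply: (is_deriv_congr h) => x /=; rewrite /ker_g /ker_g1; field.
Qed.

Lemma is_deriv_ker_K : is_deriv ker_K ker_k.
Proof.
have h2 := is_derivM (@is_deriv_id R) is_deriv_id.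
have h3 := is_derivM (@is_deriv_id R) h2.
have h := is_derivZ (m ^- 2) (is_derivB (is_derivB (is_derivZ (L / 4) h2)
  (is_derivZ 6^-1 h3)) is_deriv_ker_G).
apply: (is_deriv_congr h) => x /=; rewrite /ker_K /ker_k.
- by move: (ker_G x) => z; field.
- by move: (ker_g x) => z; field.
Qed.

Lemma is_deriv_ker_k : is_deriv ker_k ker_k1.
Proof.
have h := is_derivZ (m ^- 2) (is_derivB (is_deriv_bump L) is_deriv_ker_g).
by apply: (is_deriv_congr h) => x /=; rewrite mulrC.
Qed.

Lemma is_deriv_ker_k1 :
  is_deriv ker_k1 (fun x => m ^+ 2 * ker_k x - x * (L - x) / 2).
Proof.
have h := is_derivZ (m ^- 2) (is_derivB (is_derivB (is_deriv_cst (L / 2))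
  is_deriv_id) is_deriv_ker_g1).
apply: (is_deriv_congr h) => x /=; first by rewrite mulrC.
by rewrite /ker_k; move: (ker_g x) => z; field.
Qed.

Let kappa : R := (L / 2 - tau / m) / m ^+ 2.

Lemma ker_k0 : ker_k 0 = 0.
Proof. by rewrite /ker_k /ker_g mulr0 coshR0 sinhR0; field. Qed.

Lemma ker_kL : ker_k L = 0.
Proof.
rewrite /ker_k /ker_g /tau; have := coshR_sq t; rewrite -/t.
move: (coshR t) (sinhR t) shN0 => C S SN0 e.
have -> : 1 - C + (C - 1) / S * S = 0 by field.
by field.
Qed.

Lemma ker_k10 : ker_k1 0 = kappa.
Proof. by rewrite /ker_k1 /ker_g1 /kappa mulr0 coshR0 sinhR0; field. Qed.

Lemma ker_k1L : ker_k1 L = - kappa.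
Proof.
rewrite /ker_k1 /ker_g1 /kappa /tau; have := coshR_sq t; rewrite -/t.
move: (coshR t) (sinhR t) shN0 => C S SN0 e.
have -> : (C - 1) / S * C - S = - ((C - 1) / S).
  apply: (mulIf SN0).
  transitivity ((C - 1) * C - S ^+ 2); first by field.
  have -> : S ^+ 2 = C ^+ 2 - 1 by rewrite e; ring.
  by field.
by field; rewrite ?mN0 ?SN0.
Qed.

Lemma ker_kappa_gt0 : 0 < kappa.
Proof.
apply: divr_gt0; last exact: exprn_gt0.
have := coshR_lt_mul_sinhR t0.
rewrite subr_gt0 /tau ltr_pdivrMr // ltr_pdivrMr //.
by rewrite /t; move: (coshR _) (sinhR _) => C S; nra.
Qed.

(** With [w = t - m x], multiplying by [m^2 sinh t] turns the value into [sinh (m x) (cosh w - 1) +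
    (cosh (m x) - 1) sinh w], a sum of nonnegative terms. *)
Lemma ker_g_ge0 (x : R) : 0 <= x <= L -> 0 <= ker_g x.
Proof.
move=> /andP[x0 xL]; apply: divr_ge0; last exact: sqr_ge0.
have mx : 0 <= m * x by rewrite mulr_ge0 // ltW.
have mw : 0 <= t - m * x by rewrite /t -mulrBr mulr_ge0 ?subr_ge0 // ltW.
have := sinhR_ge0 mw; have := coshR_ge1 (t - m * x); rewrite coshRB sinhRB.
have := sinhR_ge0 mx; have := coshR_ge1 (m * x); have := coshR_sq (m * x).
rewrite /tau; move: (coshR t) (sinhR t) sh0 shN0 => C S S0 SN0.
move: (coshR _) (sinhR _) => c s e c1 s0 cw sw.
rewrite -(pmulr_lge0 _ S0).
have -> : (1 - c + (C - 1) / S * s) * S =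
    s * (C * c - S * s - 1) + (c - 1) * (S * c - C * s)
    + S * (1 + s ^+ 2 - c ^+ 2) by field.
by rewrite e subrr mulr0 addr0 addr_ge0 // mulr_ge0 // subr_ge0.
Qed.

(** This bound, like its mirror image below, is sharp to first order at its end. The right-hand
    sides are proportional to the end slopes of the Green function of [- v'' + m^2 v], so one
    constant serves for all poles. *)
Lemma ker_g_le_l (x : R) : ker_g x <= tau * sinhR (m * x) / m ^+ 2.
Proof.
rewrite /ker_g ler_pM2r ?invr_gt0 ?exprn_gt0 //.
by have := coshR_ge1 (m * x); lra.
Qed.

Lemma ker_g_le_r (x : R) : 
  ker_g x <= tau * sinhR (m * (L - x)) / m ^+ 2.
Proof.
rewrite /ker_g ler_pM2r ?invr_gt0 ?exprn_gt0 //.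
have -> : m * x = t - m * (L - x) by rewrite /t; ring.
have := coshR_ge1 (m * (L - x)).
rewrite coshRB sinhRB /tau; have := coshR_sq t.
move: (coshR t) (sinhR t) shN0 => C S SN0; move: (coshR _) (sinhR _) => c s e c1.
suff e2 : (C - 1) / S * s - (1 - (C * c - S * s) + (C - 1) / S * (S * c - C * s))
    = c - 1 by rewrite -subr_ge0 e2 subr_ge0.
apply: (mulIf SN0).
transitivity ((c - 1) * S + (C ^+ 2 - 1 - S ^+ 2) * s); first by field.
by rewrite e; ring.
Qed.

Variable N : R.
Hypothesis N0 : 0 <= N.
Hypothesis N_small :
  N * (6 * t * coshR t + 6 * t - 12 * sinhR t - t ^+ 3) <= 12 * m ^+ 5.
Let k : R := ker_K L - ker_K 0.

(** Multiplied by [12 m^5], this is exactly [N_small]. It is the sign condition on the kernel's end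
    slope in the limit where the pole tends to the opposite end. *)
Let ker_cond : N * (coshR t - 1) * kappa / m ^+ 2 <= 1 + N * k.
Proof.
have c0 : 0 < 12 * m ^+ 5 by rewrite mulr_gt0 // exprn_gt0.
rewrite -subr_ge0 -(pmulr_rge0 _ c0).
suff -> : 12 * m ^+ 5 * (1 + N * k - N * (coshR t - 1) * kappa / m ^+ 2) =
    12 * m ^+ 5 - N * (6 * t * coshR t + 6 * t - 12 * sinhR t - t ^+ 3).
  by rewrite subr_ge0.
rewrite /k /ker_K /ker_G /kappa -/t mulr0 coshR0 sinhR0 /tau.
move: (coshR t) (sinhR t) shN0 => C S SN0; rewrite /t.
by field; rewrite ?mN0 ?SN0.
Qed.

Let Nk_gt0 : 0 < 1 + N * k.
Proof.
move: N0; rewrite le_eqVlt => /predU1P[<-|N1]; first by rewrite mul0r addr0.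
apply: lt_le_trans ker_cond.
have C1 : 0 < coshR t - 1.
  have := coshR_sq t; have := coshR_gt0 t; move: sh0.
  by move: (coshR t) (sinhR t) => C S; nra.
apply: divr_gt0; last exact: exprn_gt0.
by apply: mulr_gt0 ker_kappa_gt0; exact: mulr_gt0.
Qed.

(** Here [s] is the hyperbolic sine of the scaled distance from the pole to one end; at the other
    end the Green function has slope [s / sinhR t], and the left-hand side is the slope removed
    there by [q * ker_k]. *)
Let ker_slope (s x : R) : 0 <= s -> ker_g x <= tau * s / m ^+ 2 ->
  N * ker_g x / (1 + N * k) * kappa <= s / sinhR t.
Proof.
move=> s0 gs; rewrite mulrAC ler_pdivrMr //.
apply: le_trans (_ : s / sinhR t * (N * (coshR t - 1) * kappa / m ^+ 2) <= _).
  have -> : s / sinhR t * (N * (coshR t - 1) * kappa / m ^+ 2) =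
    N * (tau * s / m ^+ 2) * kappa.
    rewrite /tau; move: kappa (coshR t) (sinhR t) shN0 => kp C S SN0.
    by field; rewrite mN0 SN0.
  by rewrite (ler_pM2r ker_kappa_gt0) ler_wpM2l.
by rewrite ler_wpM2l // divr_ge0 // ltW.
Qed.

(* The kernel of the inverse operator, seen as a function of the load point, is
   the Green function of [- v'' + m^2 v] with pole [x0] minus [q] times [ker_k].
   It is convex where it is nonnegative, so nonnegativity reduces to the signs
   of its slopes at [0] and [L], which is what the bound on [N] provides. *)
Lemma max_principle (y y1 y2 y3 Yp : R -> R) :
  is_deriv y y1 -> is_deriv y1 y2 -> is_deriv y2 y3 -> is_deriv Yp y ->
  y 0 = 0 -> y L = 0 -> y2 0 = 0 -> y2 L = 0 ->
  (forall s u : R, 0 <= s -> s <= u -> u <= L ->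
     y3 s - m ^+ 2 * y1 s + N * (Yp L - Yp 0) * s
     <= y3 u - m ^+ 2 * y1 u + N * (Yp L - Yp 0) * u) ->
  forall x, 0 < x < L -> y2 x <= 0.
Proof.
move=> hy hy1 hy2 hYp y0 yL y20 y2L Em x0 /andP[x00 x0L].
(* Chosen so that [q = N * (ker_g x0 - q * k)], that is, [N] times the mass of the kernel; the terms
   in the integral of [y] then cancel in Green's identity. *)
pose q := N * ker_g x0 / (1 + N * k).
have x0I : 0 <= x0 <= L by rewrite !ltW.
have q0 : 0 <= q.
  by rewrite divr_ge0 ?(ltW Nk_gt0) // mulr_ge0 // ker_g_ge0.
have qE : q * (1 + N * k) = N * ker_g x0 by rewrite divfK // lt0r_neq0.
(* [A] and [B] are the coefficients of the two branches of the Green function with pole [x0]; [Aq]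
   and [Bq] say that the inward end slopes stay nonnegative after subtracting [q * ker_k]. *)
pose A := sinhR (m * (L - x0)) / (m * sinhR t).
pose B := sinhR (m * x0) / (m * sinhR t).
have Aq : q * kappa <= A * m.
  have -> : A * m = sinhR (m * (L - x0)) / sinhR t.
    by rewrite /A; move: (sinhR t) shN0 => S SN0; field; rewrite ?mN0 ?SN0.
  apply: ker_slope (ker_g_le_r x0).
  by rewrite sinhR_ge0 // mulr_ge0 ?subr_ge0 // ltW.
have Bq : q * kappa <= B * m.
  have -> : B * m = sinhR (m * x0) / sinhR t.
    by rewrite /B; move: (sinhR t) shN0 => S SN0; field; rewrite ?mN0 ?SN0.
  apply: ker_slope (ker_g_le_l x0).
  by rewrite sinhR_ge0 // mulr_ge0 // ltW.
have rL : is_deriv (fun s => L - s) (fun=> -1).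
  by apply: is_deriv_ext (is_derivB (is_deriv_cst L) is_deriv_id) _ => s /=; ring.
pose pl s := A * sinhR (m * s) - q * ker_k s.
pose pl1 s := A * (m * coshR (m * s)) - q * ker_k1 s.
pose Pl s := A / m * coshR (m * s) - q * ker_K s.
pose pr s := B * sinhR (m * (L - s)) - q * ker_k s.
pose pr1 s := - (B * (m * coshR (m * (L - s)))) - q * ker_k1 s.
pose Pr s := - (B / m * coshR (m * (L - s))) - q * ker_K s.
have hPl : is_deriv Pl pl.
  have h := is_derivB (is_derivZ (A / m) (is_deriv_coshM m))
    (is_derivZ q is_deriv_ker_K).
  apply: is_deriv_ext h _ => s /=; rewrite /pl.
  by move: (ker_k s) => z; field.
have hpl : is_deriv pl pl1.
  exact: is_derivB (is_derivZ A (is_deriv_sinhM m)) (is_derivZ q is_deriv_ker_k).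
have hpl1 : is_deriv pl1 (fun s => m ^+ 2 * pl s + q * (s * (L - s) / 2)).
  have h := is_derivB (is_derivZ A (is_derivZ m (is_deriv_coshM m)))
    (is_derivZ q is_deriv_ker_k1).
  apply: is_deriv_ext h _ => s /=; rewrite /pl.
  by move: (ker_k s) => z; field.
have hPr : is_deriv Pr pr.
  have h := is_derivB (is_derivN (is_derivZ (B / m)
    (is_deriv_comp (is_deriv_coshM m) rL))) (is_derivZ q is_deriv_ker_K).
  apply: is_deriv_ext h _ => s /=; rewrite /pr.
  by move: (ker_k s) => z; field.
have hpr : is_deriv pr pr1.
  have h := is_derivB (is_derivZ B (is_deriv_comp (is_deriv_sinhM m) rL))
    (is_derivZ q is_deriv_ker_k).
  apply: is_deriv_ext h _ => s /=; rewrite /pr1.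
  by move: (ker_k1 s) => z; ring.
have hpr1 : is_deriv pr1 (fun s => m ^+ 2 * pr s + q * (s * (L - s) / 2)).
  have h := is_derivB (is_derivN (is_derivZ B (is_derivZ m
    (is_deriv_comp (is_deriv_coshM m) rL)))) (is_derivZ q is_deriv_ker_k1).
  apply: is_deriv_ext h _ => s /=; rewrite /pr.
  by move: (ker_k s) => z; field.
have bump0 (s : R) : 0 <= s <= L -> 0 <= q * (s * (L - s) / 2).
  by move=> /andP[s0 sL]; rewrite mulr_ge0 // divr_ge0 // mulr_ge0 // subr_ge0.
have pl0 : pl 0 = 0 by rewrite /pl mulr0 sinhR0 ker_k0 !mulr0 subrr.
have prL : pr L = 0 by rewrite /pr subrr mulr0 sinhR0 ker_kL !mulr0 subrr.
have pl_ge0 : forall s : R, 0 <= s <= L -> 0 <= pl s.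
  apply: (second_order_ge0 hpl hpl1 bump0 pl0).
  by rewrite /pl1 mulr0 coshR0 mulr1 ker_k10 subr_ge0.
have pr_ge0 : forall s : R, 0 <= s <= L -> 0 <= pr s.
  have h1 := is_deriv_comp hpr rL.
  have h2 := is_derivM (is_deriv_comp hpr1 rL) (is_deriv_cst (-1)).
  have h s : 0 <= s <= L -> 0 <= pr (L - s).
    apply: (second_order_ge0 (m := m) (b := L) (f := fun s => pr (L - s)) h1
      (r := fun s => q * (s * (L - s) / 2)) _ bump0).
    - by apply: is_deriv_ext h2 _ => z /=; move: (pr _) => w; field.
    - by rewrite subr0.
    - rewrite subr0 /pr1 subrr mulr0 coshR0 mulr1 ker_k1L.
      by move: Bq; move: kappa => kp; lra.
  move=> s /andP[s0 sL]; have -> : s = L - (L - s) by ring.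
  by apply: h; lra.
have plI s : 0 <= s <= x0 -> 0 <= pl s.
  by move=> /andP[s0 sx]; apply: pl_ge0; rewrite s0 (le_trans sx) // ltW.
have prI s : x0 <= s <= L -> 0 <= pr s.
  by move=> /andP[s0 sx]; apply: pr_ge0; rewrite sx (le_trans _ s0) // ltW.
(* Green's inequality is added over [[0, x0]] and [[x0, L]]. The branches agree at [x0], so the load
   terms cancel there, and they vanish at the outer ends; the unit drop of the slope at [x0]
   isolates [y2 x0]. *)
have := green_le hy hy1 hy2 hYp hPl hpl hpl1 (ltW x00) plI
  (fun s u a b c => Em s u a b (le_trans c (ltW x0L))).
have := green_le hy hy1 hy2 hYp hPr hpr hpr1 (ltW x0L) prI
  (fun s u a b c => Em s u (le_trans (ltW x00) a) b c).
have plr : pl x0 = pr x0.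
  by rewrite /pl /pr /A /B; move: (ker_k x0) (_ * _)^-1 => z w; ring.
have mx0 : m * (L - x0) = t - m * x0 by rewrite /t; ring.
have jump : pl1 x0 = pr1 x0 + 1.
  rewrite /pl1 /pr1 /A /B mx0 coshRB sinhRB; have := coshR_sq (m * x0).
  move: (ker_k1 x0) (coshR t) (sinhR t) shN0 => z C S SN0.
  move: (coshR _) (sinhR _) => c s e.
  have -> : 1 = c ^+ 2 - s ^+ 2 by rewrite e; ring.
  by field; rewrite ?mN0 ?SN0.
have mass : Pl x0 - Pl 0 + (Pr L - Pr x0) = ker_g x0 - q * k.
  rewrite /Pl /Pr /A /B /k /ker_g /tau subrr mx0 mulr0 coshR0 coshRB sinhRB.
  have := coshR_sq (m * x0).
  move: (ker_K x0) (ker_K 0) (ker_K L) (coshR t) (sinhR t) shN0 => K1 K2 K3 C S SN0.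
  move: (coshR _) (sinhR _) => c s e.
  transitivity ((1 - c + (C - 1) / S * s) / m ^+ 2 - q * (K3 - K2)
    + (c ^+ 2 - (1 + s ^+ 2)) / m ^+ 2); first by field; rewrite ?mN0 ?SN0.
  by rewrite e subrr mul0r addr0.
rewrite /green_form y0 yL y20 y2L pl0 prL plr jump.
move: mass qE; set Y := Yp L - Yp 0.
have -> : Yp L = Y + Yp 0 by rewrite /Y; ring.
move: (Pl x0) (Pl 0) (Pr L) (Pr x0) (pr x0) (pr1 x0) => Pl1 Pl0 PrL Pr0 p p1.
move: (pl1 0) (pr1 L) (ker_g x0) => p0 pL g mass qE.
have -> : PrL = g - q * k - Pl1 + Pl0 + Pr0 by rewrite -mass; ring.
have : Y * (q * (1 + N * k) - N * g) = 0 by rewrite qE subrr mulr0.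
move: k Y (Yp 0) (Yp x0) (y x0) (y1 0) (y1 L) (y1 x0) (y2 x0) (y3 0) (y3 L) (y3 x0).
move=> k' Y' *; lra.
Qed.
End Kernels.

(** * The linear problem *)

Definition C3 {R : realType} (y : R -> R) : Prop :=
  [/\ is_deriv y (d1 y), is_deriv (d1 y) (d2 y) & is_deriv (d2 y) (d3 y)].

(* The once integrated form of [y'''' - M y'' + N \int y = H'] with Navier
   boundary conditions; it makes sense for a nondifferentiable [H]. *)
Definition lin_sol {R : realType} (L M N : R) (H y : R -> R) : Prop :=
  [/\ C3 y, nav_bc L y & forall x : R, 0 <= x <= L ->
    d3 y x - d3 y 0 = M * (d1 y x - d1 y 0) - N * intR 0 L y * x + (H x - H 0)].

(** The bound on [N] with the denominator of [sigmaR] cleared, using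
    [(4 m^2 / L^3) * 3 (m L)^3 = 12 m^5]. In this form [N = 0] qualifies, so the maximum principle
    also covers the uncoupled problem. *)
Definition small_coupling {R : realType} (L M N : R) : Prop :=
  let m := Num.sqrt M in
  let t := m * L in
  N * (6 * t * coshR t + 6 * t - 12 * sinhR t - t ^+ 3) <= 12 * m ^+ 5.

Definition nondecr_on {R : realType} (L : R) (H : R -> R) : Prop :=
  forall s t : R, 0 <= s -> s <= t -> t <= L -> H s <= H t.

Lemma is_deriv_C3 {R : realType} (y y1 y2 y3 : R -> R) :
  is_deriv y y1 -> is_deriv y1 y2 -> is_deriv y2 y3 ->
  [/\ C3 y, d1 y = y1, d2 y = y2 & d3 y = y3].
Proof.
move=> h1 h2 h3.
have e1 := is_deriv_d1 h1.
have e2 : d2 y = y2 by rewrite -[LHS]/(d1 (d1 y)) e1 (is_deriv_d1 h2).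
have e3 : d3 y = y3 by rewrite -[LHS]/(d1 (d2 y)) e2 (is_deriv_d1 h3).
split; [|exact: e1|exact: e2|exact: e3].
by split; rewrite ?e1 ?e2 ?e3.
Qed.

Lemma C3_continuous {R : realType} (y : R -> R) : C3 y -> continuous y.
Proof. by case=> /is_deriv_continuous. Qed.

Lemma C3_lincomb {R : realType} (k l : R) (u v : R -> R) :
  C3 u -> C3 v ->
  let w x := k * u x + l * v x in
  [/\ C3 w, d1 w = (fun x => k * d1 u x + l * d1 v x),
      d2 w = (fun x => k * d2 u x + l * d2 v x)
    & d3 w = (fun x => k * d3 u x + l * d3 v x)].
Proof.
move=> [u1 u2 u3] [v1 v2 v3] w; apply: is_deriv_C3.
- exact: is_derivD (is_derivZ k u1) (is_derivZ l v1).
- exact: is_derivD (is_derivZ k u2) (is_derivZ l v2).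
- exact: is_derivD (is_derivZ k u3) (is_derivZ l v3).
Qed.

Lemma lin_sol_lincomb {R : realType} (L M N k l : R) (G H u v : R -> R) :
  0 <= L -> lin_sol L M N G u -> lin_sol L M N H v ->
  lin_sol L M N (fun x => k * G x + l * H x) (fun x => k * u x + l * v x).
Proof.
move=> L0 [Cu [u0 [uL [u20 u2L]]] eu] [Cv [v0 [vL [v20 v2L]]] ev].
have [Cw e1 e2 e3] := C3_lincomb k l Cu Cv.
split; first exact: Cw.
  by rewrite /nav_bc e2 u0 uL u20 u2L v0 vL v20 v2L !mulr0 !addr0.
move=> x xL; rewrite e1 e3 (intR_lincomb _ _ L0 (C3_continuous Cu) (C3_continuous Cv)).
have := eu x xL; have := ev x xL.
move: (d3 u x) (d3 u 0) (d3 v x) (d3 v 0) (d1 u x) (d1 u 0) (d1 v x) (d1 v 0).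
move: (intR 0 L u) (intR 0 L v) (G x) (G 0) (H x) (H 0).
move=> U V Gx G0 Hx H0 a1 a2 b1 b2 c1 c2 e f1 eb ea.
have -> : k * a1 + l * b1 - (k * a2 + l * b2) = k * (a1 - a2) + l * (b1 - b2).
  by ring.
by rewrite ea eb; ring.
Qed.

(** The chords joining the point over [x] to the two ends have slopes [y1 c >= y1 d] with
    [c < x < d], and [L * y x] is the difference of these slopes times [x (L - x)]. *)
Lemma concave_ge0 {R : realType} (L : R) (y y1 y2 : R -> R) :
  is_deriv y y1 -> is_deriv y1 y2 -> y 0 = 0 -> y L = 0 ->
  (forall x : R, 0 <= x <= L -> y2 x <= 0) ->
  forall x : R, 0 <= x <= L -> 0 <= y x.
Proof.
move=> h1 h2 y0 yL y20 x /andP[]; rewrite le_eqVlt => /predU1P[<-|x0].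
  by rewrite y0.
rewrite le_eqVlt => /predU1P[->|xL]; first by rewrite yL.
have [c /andP[c0 cx]] := is_deriv_MVT h1 x0.
have [d /andP[d0 dx]] := is_deriv_MVT h1 xL.
have : y1 d <= y1 c.
  by apply: (is_deriv_nonincr h2 y20); apply/ltW => //; exact: lt_trans cx d0.
rewrite y0 yL !subr0 sub0r; move: (y x) (y1 c) (y1 d) => p q r rq e1 e2.
rewrite -(pmulr_lge0 _ (lt_trans x0 xL)).
have -> : p * L = (q - r) * (x * (L - x)).
  have -> : p * L = p * (L - x) - (- p) * x by ring.
  by rewrite e1 e2; ring.
by rewrite mulr_ge0 ?subr_ge0 // mulr_ge0 ?subr_ge0 // ltW.
Qed.

Lemma lin_sol_d2_le0 {R : realType} (L M N : R) (H y : R -> R) :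
  0 < L -> 0 < M -> 0 <= N -> small_coupling L M N -> nondecr_on L H ->
  lin_sol L M N H y -> forall x : R, 0 <= x <= L -> d2 y x <= 0.
Proof.
move=> L0 M0 N0 sm Hm [[h1 h2 h3] [y0 [yL [y20 y2L]]] e] x /andP[].
have cy := is_deriv_continuous h1.
have [Yp hYp] := antiderivative_exists cy.
rewrite le_eqVlt => /predU1P[<-|x0]; first by rewrite y20.
rewrite le_eqVlt => /predU1P[->|xL]; first by rewrite y2L.
have m0 : 0 < Num.sqrt M by rewrite sqrtr_gt0.
have IE := intR_FTC (ltW L0) hYp cy.
apply: (max_principle m0 L0 N0 sm h1 h2 h3 hYp y0 yL y20 y2L); last first.
  by rewrite x0.
move=> s u s0 su uL; rewrite sqr_sqrtr ?(ltW M0) // -IE.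
have es := e s; have eu := e u.
rewrite s0 (le_trans su uL) in es; rewrite uL (le_trans s0 su) in eu.
have := Hm s u s0 su uL; move: (es isT) (eu isT).
move: (d3 y s) (d3 y u) (d3 y 0) (d1 y s) (d1 y u) (d1 y 0) (H s) (H u) (H 0).
move: (intR 0 L y) => Y a1 a2 a3 b1 b2 b3 c1 c2 c3 e1 e2 e3.
by clear -e1 e2 e3; lra.
Qed.

Lemma lin_sol_ge0 {R : realType} (L M N : R) (H y : R -> R) :
  0 < L -> 0 < M -> 0 <= N -> small_coupling L M N -> nondecr_on L H ->
  lin_sol L M N H y -> forall x : R, 0 <= x <= L -> 0 <= y x.
Proof.
move=> L0 M0 N0 sm Hm yS.
have d2le := lin_sol_d2_le0 L0 M0 N0 sm Hm yS.
have [[h1 h2 _] [y0 [yL _]] _] := yS.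
exact: concave_ge0 h1 h2 y0 yL d2le.
Qed.

Lemma small_coupling0 {R : realType} (L M : R) : small_coupling L M 0.
Proof. by rewrite /small_coupling mul0r mulr_ge0 // exprn_ge0 // sqrtr_ge0. Qed.

Lemma lin_sol_le {R : realType} (L M N : R) (G H u v : R -> R) :
  0 < L -> 0 < M -> 0 <= N -> small_coupling L M N ->
  nondecr_on L (fun x => H x - G x) ->
  lin_sol L M N G u -> lin_sol L M N H v ->
  forall x : R, 0 <= x <= L -> u x <= v x /\ d2 v x <= d2 u x.
Proof.
move=> L0 M0 N0 sm HG uS vS x xL.
have wS := lin_sol_lincomb (-1) 1 (ltW L0) uS vS.
have HG' : nondecr_on L (fun x => -1 * G x + 1 * H x).
  by move=> s t s0 st tL; have := HG s t s0 st tL; lra.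
have [uC vC] : C3 u /\ C3 v by case: uS; case: vS.
have [_ _ e2 _] := C3_lincomb (-1) 1 uC vC.
have := lin_sol_d2_le0 L0 M0 N0 sm HG' wS xL.
have := lin_sol_ge0 L0 M0 N0 sm HG' wS xL.
rewrite e2; move: (d2 u x) (d2 v x) (u x) (v x) => a b c d.
by move=> *; split; lra.
Qed.

(** Only increments of the third derivative are prescribed, so [y'] may be sought as [W - ka] with
    [W'' = M W + H]; variation of constants provides [W] with zero slope at the origin. *)
Lemma lin_sol_exists_uncoupled {R : realType} (L M : R) (H : R -> R) :
  0 < L -> 0 < M -> continuous H -> exists y, lin_sol L M 0 H y.
Proof.
move=> L0 M0 cH; pose m := Num.sqrt M.
have m0 : 0 < m by rewrite sqrtr_gt0.
have mN0 : m != 0 by exact: lt0r_neq0.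
have MM : m ^+ 2 = M by rewrite sqr_sqrtr // ltW.
have [A hA] : exists A, is_deriv A (fun x => coshR (m * x) * H x).
  apply: antiderivative_exists => x; apply: cvgM; last exact: cH.
  exact: (is_deriv_continuous (is_deriv_coshM m)).
have [B hB] : exists B, is_deriv B (fun x => sinhR (m * x) * H x).
  apply: antiderivative_exists => x; apply: cvgM; last exact: cH.
  exact: (is_deriv_continuous (is_deriv_sinhM m)).
have sh0 : 0 < sinhR (m * L) by rewrite sinhR_gt0 // mulr_gt0.
pose V x := coshR (m * x) * (A x - A 0) - sinhR (m * x) * (B x - B 0).
(* The multiple of the hyperbolic cosine for which [W1 L], the second derivative of the solution at
   [L], vanishes. *)
pose al := - V L / (m * sinhR (m * L)).
pose W x := m^-1 * (sinhR (m * x) * (A x - A 0) - coshR (m * x) * (B x - B 0))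
            + al * coshR (m * x).
pose W1 x := V x + al * (m * sinhR (m * x)).
have hA0 := is_derivB hA (is_deriv_cst (A 0)).
have hB0 := is_derivB hB (is_deriv_cst (B 0)).
have hW : is_deriv W W1.
  have h := is_derivD (is_derivZ m^-1 (is_derivB
     (is_derivM (is_deriv_sinhM m) hA0) (is_derivM (is_deriv_coshM m) hB0)))
     (is_derivZ al (is_deriv_coshM m)).
  by apply: is_deriv_ext h _ => x /=; rewrite /W1 /V; field.
have hW1 : is_deriv W1 (fun x => M * W x + H x).
  have h := is_derivD (is_derivB (is_derivM (is_deriv_coshM m) hA0)
    (is_derivM (is_deriv_sinhM m) hB0))
     (is_derivZ al (is_derivZ m (is_deriv_sinhM m))).
  apply: is_deriv_ext h _ => x /=; rewrite /W -MM; have := coshR_sq (m * x).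
  move: (coshR _) (sinhR _) (H x) => c s Hx e.
  transitivity (m ^+ 2 * (m^-1 * (s * (A x - A 0) - c * (B x - B 0)) + al * c)
    + (c ^+ 2 - s ^+ 2) * Hx); first by field.
  by rewrite e; ring.
have [P hP] := antiderivative_exists (is_deriv_continuous hW).
(* Subtracting this line enforces the value zero at [L] without changing the second derivative or
   the increments of the first. *)
pose ka := (P L - P 0) / L.
have h1 : is_deriv (fun x => P x - P 0 - ka * x) (fun x => W x - ka).
  have h := is_derivB (is_derivB hP (is_deriv_cst (P 0))) (is_derivZ ka is_deriv_id).
  by apply: is_deriv_ext h _ => x /=; ring.
have h2 : is_deriv (fun x => W x - ka) W1.
  by apply: is_deriv_ext (is_derivB hW (is_deriv_cst ka)) _ => x /=; rewrite subr0.
have [Cy e1 e2 e3] := is_deriv_C3 h1 h2 hW1.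
exists (fun x => P x - P 0 - ka * x); split; first exact: Cy.
  rewrite /nav_bc e2; split; [by rewrite mulr0 subrr subr0|split; [|split]].
  - by rewrite /ka divfK ?subrr // lt0r_neq0.
  - by rewrite /W1 /V mulr0 sinhR0 !subrr !mulr0 subrr addr0.
  - rewrite /W1 /al; move: (V L) (sinhR _) sh0 => v s s0.
    by field; rewrite mN0 lt0r_neq0.
move=> x _; rewrite e1 e3; move: (W x) (W 0) (H x) (H 0) => ? ? ? ?; ring.
Qed.

(** Superposition: with [u] and [v] the uncoupled solutions for [H] and for the unit load,
    [u - N Y v] works as soon as its own integral is [Y]. This determines [Y], because [v >= 0]
    makes [1 + N * intR 0 L v] positive. *)
Lemma lin_sol_exists {R : realType} (L M N : R) (H : R -> R) :
  0 < L -> 0 < M -> 0 <= N -> continuous H -> exists y, lin_sol L M N H y.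
Proof.
move=> L0 M0 N0 cH.
have [u uS] := lin_sol_exists_uncoupled L0 M0 cH.
have cid : continuous (fun x : R => x) by exact: is_deriv_continuous is_deriv_id.
have [v vS] := lin_sol_exists_uncoupled L0 M0 cid.
have [uC vC] : C3 u /\ C3 v by case: uS; case: vS.
have V0 : 0 <= intR 0 L v.
  have v0 := lin_sol_ge0 L0 M0 (lexx 0) (small_coupling0 L M) _ vS.
  have c0 : continuous (fun _ : R => 0 : R).
    exact: is_deriv_continuous (is_deriv_cst _).
  have := intR_le (ltW L0) c0 (C3_continuous vC) (v0 _).
  rewrite (intR_FTC (ltW L0) (is_deriv_cst 0) c0) subrr; apply.
  by move=> s t.
have d0 : 0 < 1 + N * intR 0 L v by rewrite ltr_pwDl // mulr_ge0.
pose Y := intR 0 L u / (1 + N * intR 0 L v).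
have wS := lin_sol_lincomb 1 (- (N * Y)) (ltW L0) uS vS.
have [wC e1 e2 e3] := C3_lincomb 1 (- (N * Y)) uC vC.
exists (fun x => 1 * u x + - (N * Y) * v x).
case: wS => _ bc e; split; [exact: wC|exact: bc|] => x xL; rewrite (e x xL).
rewrite (intR_lincomb _ _ (ltW L0) (C3_continuous uC) (C3_continuous vC)).
have -> : 1 * intR 0 L u + - (N * Y) * intR 0 L v = Y.
  rewrite /Y; move: (intR 0 L u) (intR 0 L v) d0 => U V d0.
  by field; exact: lt0r_neq0.
by move: (d1 _ x) (d1 _ 0) => ? ?; ring.
Qed.

(** * Load functions in L^1 *)

Lemma ae_imp {R : realType} (P Q : R -> Prop) :
  (\forall x \ae (@lebesgue_measure R), P x) -> (forall x, P x -> Q x) ->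
  \forall x \ae (@lebesgue_measure R), Q x.
Proof.
move=> aP PQ; apply: filterS aP => //.
exact: (ae_filter_ringOfSetsType (@lebesgue_measure R)).
Qed.

Lemma ae_and {R : realType} (P Q : R -> Prop) :
  (\forall x \ae (@lebesgue_measure R), P x) ->
  (\forall x \ae (@lebesgue_measure R), Q x) ->
  \forall x \ae (@lebesgue_measure R), P x /\ Q x.
Proof.
move=> aP aQ; apply: filterI => //.
exact: (ae_filter_ringOfSetsType (@lebesgue_measure R)).
Qed.

Lemma ae_neq {R : realType} (a : R) :
  \forall x \ae (@lebesgue_measure R), x <> a.
Proof.
exists [set a]; split=> //; first exact: lebesgue_measure_set1.
by move=> x /= /contrapT.
Qed.

Lemma ae_itv_oo_cc {R : realType} (L : R) (Q : R -> Prop) :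
  (\forall x \ae (@lebesgue_measure R), `]0, L[%classic x -> Q x) ->
  \forall x \ae (@lebesgue_measure R), `[0, L]%classic x -> Q x.
Proof.
move=> aQ; apply: ae_imp (ae_and aQ (ae_and (ae_neq 0) (ae_neq L))) _.
move=> x [h [/eqP x0 /eqP xL]] /=; rewrite in_itv /= => /andP[a b]; apply: h.
by rewrite /= in_itv /= !lt_neqAle a b xL eq_sym x0.
Qed.

Lemma integrable_subitv {R : realType} (L a b : R) (h : R -> R) :
  (@lebesgue_measure R).-integrable `[0, L] (EFin \o h) -> 0 <= a -> b <= L ->
  (@lebesgue_measure R).-integrable `[a, b] (EFin \o h).
Proof.
move=> hi a0 bL; apply: integrableS hi => // x /=; rewrite !in_itv /=.
by move=> /andP[ax xb]; rewrite (le_trans a0 ax) (le_trans xb bL).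
Qed.

Lemma continuous_integrable {R : realType} (a b : R) (h : R -> R) :
  continuous h -> (@lebesgue_measure R).-integrable `[a, b] (EFin \o h).
Proof.
move=> ch; apply: continuous_compact_integrable; first exact: segment_compact.
exact: continuous_subspaceT.
Qed.

Lemma intR_ae {R : realType} (L x : R) (g h : R -> R) :
  (@lebesgue_measure R).-integrable `[0, L] (EFin \o g) ->
  (@lebesgue_measure R).-integrable `[0, L] (EFin \o h) ->
  (\forall x \ae (@lebesgue_measure R), `[0, L]%classic x -> g x = h x) ->
  x <= L -> intR 0 x g = intR 0 x h.
Proof.
move=> gi hi gh xL; congr fine; apply: ae_eq_integral => //.
- exact/measurable_int/(integrable_subitv gi).
- exact/measurable_int/(integrable_subitv hi).
- apply: ae_imp gh _ => z gh /=; rewrite in_itv /= => /andP[z0 zx].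
  by rewrite gh //= in_itv /= z0 (le_trans zx xL).
Qed.

Lemma integrable_add_continuous {R : realType} (L : R) (F f h : R -> R) :
  is_deriv F f -> continuous f ->
  (@lebesgue_measure R).-integrable `[0, L] (EFin \o h) ->
  (@lebesgue_measure R).-integrable `[0, L] (EFin \o (fun x => f x + h x)) /\
  forall x : R, 0 <= x <= L ->
    intR 0 x (fun x => f x + h x) = F x - F 0 + intR 0 x h.
Proof.
move=> Ff cf hi; split.
  exact: (integrableD _ (continuous_integrable 0 L cf) hi).
move=> x /andP[x0 xL]; rewrite -(intR_FTC x0 Ff cf) /intR RintegralD //.
- exact: continuous_integrable.
- exact: integrable_subitv hi _ _.
Qed.

Lemma intR_nondecr {R : realType} (L : R) (h : R -> R) :
  (@lebesgue_measure R).-integrable `[0, L] (EFin \o h) ->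
  (\forall x \ae (@lebesgue_measure R), `[0, L]%classic x -> 0 <= h x) ->
  nondecr_on L (fun x => intR 0 x h).
Proof.
move=> hi h0 s t s0 st tL; rewrite -subr_ge0 /intR.
rewrite Rintegral_itvB ?bnd_simp //; last exact: integrable_subitv hi _ _.
have sub : `]s, t] `<=` `[0, L].
  move=> z /=; rewrite !in_itv /= => /andP[sz zt].
  by rewrite (le_trans s0 (ltW sz)) (le_trans zt tL).
have hi' : (@lebesgue_measure R).-integrable `]s, t] (EFin \o h).
  exact: integrableS hi.
(* The sign of [h] is known only almost everywhere; its absolute value is nonnegative at every point
   and has the same integral. *)
have -> : (\int[lebesgue_measure]_(x in `]s, t]) h x =
    \int[lebesgue_measure]_(x in `]s, t]) `|h x|)%R.
  congr fine; apply: ae_eq_integral => //.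
  - exact: measurable_int hi'.
  - exact: (measurable_int _ (integrable_norm hi')).
  - by apply: ae_imp h0 _ => z hz /= /sub/hz h0z; rewrite ger0_norm.
exact: Rintegral_ge0.
Qed.

Lemma intR_eq0_ae {R : realType} (L : R) (h : R -> R) :
  (@lebesgue_measure R).-integrable `[0, L] (EFin \o h) ->
  (\forall x \ae (@lebesgue_measure R), `[0, L]%classic x -> 0 <= h x) ->
  intR 0 L h = 0 ->
  \forall x \ae (@lebesgue_measure R), `[0, L]%classic x -> h x = 0.
Proof.
move=> hi h0 I0; have mh := measurable_int _ hi.
have e : (\int[lebesgue_measure]_(x in `[0%R, L]) (EFin \o h) x =
    \int[lebesgue_measure]_(x in `[0%R, L]) `|(EFin \o h) x|)%E.
  apply: ae_eq_integral => //.
  - exact: (measurable_int _ (integrable_abse hi)).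
  - by apply: ae_imp h0 _ => z hz /= /hz h0z; rewrite ger0_norm.
have : ae_eq (@lebesgue_measure R) `[0, L]%classic (EFin \o h) (cst 0%E).
  apply/ae_eq_integral_abs => //; rewrite -e.
  have fi := integrable_fin_num _ hi.
  by rewrite -[LHS]fineK ?fi // [fine _]I0.
by move=> h'; apply: ae_imp h' _ => z hz zL; have /= [] := hz zL.
Qed.

(** The integral is continuous only relative to [[0, L]]; composition with the clamp [cl] onto this
    interval extends it by constants to the whole line. *)
Lemma L1_primitive {R : realType} (L : R) (p : R -> R) :
  0 <= L -> (@lebesgue_measure R).-integrable `[0, L] (EFin \o p) ->
  exists P, continuous P /\ forall x : R, 0 <= x <= L -> P x = intR 0 x p.
Proof.
move=> L0 hp; pose cl (x : R) := Num.max (Num.min x L) 0.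
have clI x : `[0, L]%classic (cl x).
  by rewrite /= in_itv /= /cl le_max lexx orbT ge_max L0 andbT ge_min lexx orbT.
have cmin : continuous (fun x : R => Num.min x L).
  by move=> x; apply: continuous_min; [exact: cvg_id|exact: cvg_cst].
have cmax : continuous (fun x : R => Num.max x 0).
  by move=> x; apply: continuous_max; [exact: cvg_id|exact: cvg_cst].
have ccl : continuous cl by exact: continuous_compose cmin cmax.
exists (fun x => intR 0 (cl x) p); split; last first.
  move=> x /andP[x0 xL]; by rewrite /cl (min_idPl xL) (max_idPl x0).
have cw := parameterized_integral_continuous L0 hp.
move=> x; apply: (@cvg_comp _ _ _ cl (fun y => intR 0 y p) _
   (within `[0, L] (nbhs (cl x)))); last first.
  by move/subspace_continuousP: cw => /(_ (cl x) (clI x)).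
move=> W hW.
have h : nbhs x (fun z => `[0, L]%classic (cl z) -> W (cl z)) := ccl x _ hW.
by apply: filterS h => z; apply; exact: clI.
Qed.

(** In one direction the equation is integrated over [[0, x]]. In the other, the equation itself
    serves as the definition of the weak fourth derivative, [M y'' - N Y + h]. *)
Lemma W41_lin_sol {R : realType} (L M N : R) (h H y : R -> R) :
  0 < L -> (@lebesgue_measure R).-integrable `[0, L] (EFin \o h) ->
  (forall x : R, 0 <= x <= L -> H x - H 0 = intR 0 x h) ->
  (exists g, W41 L y g /\
    (\forall x \ae (@lebesgue_measure R), `]0, L[%classic x ->
        g x - M * d2 y x + N * intR 0 L y = h x) /\
    nav_bc L y) <-> lin_sol L M N H y.
Proof.
move=> L0 hi hH; set Y := intR 0 L y.
have der : C3 y -> is_deriv (fun x => M * d1 y x + - (N * Y) * x)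
    (fun x => M * d2 y x - N * Y) /\ continuous (fun x => M * d2 y x - N * Y).
  move=> [h1 h2 h3]; split.
    have h' := is_derivD (is_derivZ M h2) (is_derivZ (- (N * Y)) is_deriv_id).
    by apply: is_deriv_ext h' _ => x /=; rewrite mulr1.
  apply: continuous_subc => x; apply: cvgMr.
  exact: (is_deriv_continuous h3).
split.
- case=> g [[D1 [D2 [D3 [gi gE]]]] [ae bc]].
  have Cy : C3 y by split; exact: derivable_is_deriv.
  split; [exact: Cy|exact: bc|] => x xL.
  have [hF cf] := der Cy.
  have [fi fE] := integrable_add_continuous hF cf hi.
  have e : intR 0 x g = intR 0 x (fun x => M * d2 y x - N * Y + h x).
    apply: (intR_ae gi fi); last by case/andP: xL.
    apply: ae_itv_oo_cc; apply: ae_imp ae _ => z hz zL; rewrite -(hz zL) -/Y.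
    by move: (g z) (d2 y z) => a b; ring.
  rewrite (gE x xL) e (fE x xL) (hH x xL) -/Y.
  by move: (d3 y 0) (d1 y x) (d1 y 0) (intR 0 x h) => ? ? ? ?; ring.
- case=> Cy bc eq; have [hF cf] := der Cy.
  have [fi fE] := integrable_add_continuous hF cf hi.
  exists (fun x => M * d2 y x - N * Y + h x); split; [|split; [|exact: bc]].
    have [h1 h2 h3] := Cy.
    split; [|split; [|split; [|split]]].
    + by move=> x; exact: is_deriv_derivable h1.
    + by move=> x; exact: is_deriv_derivable h2.
    + by move=> x; exact: is_deriv_derivable h3.
    + exact: fi.
    + move=> x xL; rewrite (fE x xL) -(hH x xL); have := eq x xL; rewrite -/Y.
      move: (d3 y 0) (d3 y x) (d1 y x) (d1 y 0) (H x) (H 0) => a b c d e f.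
      by move/(canRL (subrK _)) => ->; ring.
  apply: ae_imp (ae_neq 0) _ => x _ _; rewrite -/Y; move: (d2 y x) (h x) => a b; ring.
Qed.

(** * A priori bounds and uniqueness *)

(* [U = e^{mx} (f' - m f)] is nonincreasing and [(e^{-mx} f)' = e^{-2mx} U], so
   [e^{-mx} f] first increases and then decreases. *)
Lemma second_order_bvp_ge0 {R : realType} (m L : R) (f f1 f2 : R -> R) :
  is_deriv f f1 -> is_deriv f1 f2 ->
  (forall x : R, 0 <= x <= L -> f2 x <= m ^+ 2 * f x) ->
  0 <= f 0 -> 0 <= f L -> forall x : R, 0 <= x <= L -> 0 <= f x.
Proof.
move=> h1 h2 hf f0 fL x /andP[x0 xL].
have de (k : R) : is_deriv (fun x => expR (k * x)) (fun x => k * expR (k * x)).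
  apply: is_deriv_ext.
    exact: (is_deriv_comp (fun x => is_derive_expR x) (is_derivZ k is_deriv_id)).
  by move=> z /=; ring.
pose U z := expR (m * z) * (f1 z - m * f z).
have hU : is_deriv U (fun z => expR (m * z) * (f2 z - m ^+ 2 * f z)).
  apply: is_deriv_ext (is_derivM (de m) (is_derivB h2 (is_derivZ m h1))) _.
  by move=> z /=; ring.
have Um := is_deriv_nonincr (a := 0) (b := L) hU.
have {}Um : forall s t : R, 0 <= s -> s <= t -> t <= L -> U t <= U s.
  by apply: Um => z zL; rewrite pmulr_rle0 ?expR_gt0 // subr_le0 hf.
have hg : is_deriv (fun z => expR (- m * z) * f z)
    (fun z => expR (- m * z) * (f1 z - m * f z)).
  by apply: is_deriv_ext (is_derivM (de (- m)) h1) _ => z /=; ring.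
have sg z : 0 <= expR (- m * z) * (f1 z - m * f z) = (0 <= U z).
  by rewrite !pmulr_rge0 ?expR_gt0.
have sl z : (expR (- m * z) * (f1 z - m * f z) <= 0) = (U z <= 0).
  by rewrite !pmulr_rle0 ?expR_gt0.
rewrite -(pmulr_rge0 _ (expR_gt0 (- m * x))).
case: (leP 0 (U x)) => [Ux|/ltW Ux].
- apply: (le_trans (y := expR (- m * 0) * f 0)).
    by rewrite mulr_ge0 // expR_ge0.
  apply: (is_deriv_nondecr hg _ (lexx 0) x0 (lexx x)) => z /andP[z0 zx].
  by rewrite sg; apply: le_trans Ux _; exact: Um.
- apply: (le_trans (y := expR (- m * L) * f L)).
    by rewrite mulr_ge0 // expR_ge0.
  apply: (is_deriv_nonincr hg _ (lexx x) xL (lexx L)) => z /andP[z0 zx].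
  by rewrite sl; apply: le_trans _ Ux; exact: Um.
Qed.

(** The constant [eps / M] is a supersolution for both [f] and [- f]; the sign [k] treats the two at
    once. *)
Lemma second_order_bvp_bound {R : realType} (M L eps : R) (f f1 f2 e : R -> R) :
  0 < M -> 0 <= eps -> is_deriv f f1 -> is_deriv f1 f2 ->
  f 0 = 0 -> f L = 0 ->
  (forall x : R, 0 <= x <= L -> f2 x = M * f x + e x) ->
  (forall x : R, 0 <= x <= L -> `|e x| <= eps) ->
  forall x : R, 0 <= x <= L -> `|f x| <= eps / M.
Proof.
move=> M0 eps0 h1 h2 f0 fL fE eB.
have MM : Num.sqrt M ^+ 2 = M by rewrite sqr_sqrtr // ltW.
have b0 : 0 <= eps / M by rewrite divr_ge0 // ltW.
have Mb : M * (eps / M) = eps by rewrite mulrC divfK // lt0r_neq0.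
have up (k : R) : `|k| = 1 -> forall x : R, 0 <= x <= L -> 0 <= eps / M - k * f x.
  move=> k1; have hk1 := is_derivB (is_deriv_cst (eps / M)) (is_derivZ k h1).
  have hk2 := is_derivB (is_deriv_cst 0) (is_derivZ k h2).
  apply: (second_order_bvp_ge0 (m := Num.sqrt M) hk1 hk2).
  - move=> x xL; rewrite MM (fE x xL) mulrBr Mb.
    have : - (k * e x) <= eps.
      apply: le_trans (ler_norm _) _; rewrite normrN normrM k1 mul1r.
      exact: eB.
    by move: (f x) (e x) => fx ex; lra.
  - by rewrite f0 mulr0 subr0.
  - by rewrite fL mulr0 subr0.
move=> x xL; rewrite ler_norml; apply/andP; split.
- have := up (-1) _ x xL; rewrite normrN normr1 => /(_ erefl).
  by move: (f x) => fx; lra.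
- have := up 1 _ x xL; rewrite normr1 => /(_ erefl).
  by move: (f x) => fx; lra.
Qed.

(** As a function of [s], the difference of the two sides is concave on [[0, x]] and vanishes at
    both ends. *)
Lemma concave_chord {R : realType} (L : R) (y y1 y2 : R -> R) :
  is_deriv y y1 -> is_deriv y1 y2 -> y 0 = 0 ->
  (forall x : R, 0 <= x <= L -> y2 x <= 0) ->
  forall s x : R, 0 <= s -> s <= x -> x <= L -> y x * s <= x * y s.
Proof.
move=> h1 h2 y0 y2le s x s0 sx xL; rewrite -subr_ge0.
have x0 := le_trans s0 sx.
have hk1 := is_derivB (is_derivZ x h1) (is_derivZ (y x) is_deriv_id).
have hk2 := is_derivB (is_derivZ x h2) (is_deriv_cst (y x * 1)).
apply: (concave_ge0 (L := x) hk1 hk2).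
- by rewrite y0 !mulr0 subrr.
- by rewrite mulrC subrr.
- move=> z /andP[z0 zx]; rewrite subr0 mulr_ge0_le0 // y2le // z0.
  exact: le_trans zx xL.
- by rewrite s0.
Qed.

(** By concavity [y] lies above the tent with apex [y x] over [x], and the tent lies above the
    parabola [y x * s (L - s) / L^2], which can be integrated without splitting at [x]. *)
Lemma concave_above_parabola {R : realType} (L : R) (y y1 y2 : R -> R) :
  is_deriv y y1 -> is_deriv y1 y2 -> y 0 = 0 -> y L = 0 ->
  (forall x : R, 0 <= x <= L -> y2 x <= 0) ->
  forall s x : R, 0 <= s <= L -> 0 <= x <= L ->
  y x * (s * (L - s)) <= L ^+ 2 * y s.
Proof.
move=> h1 h2 y0 yL y2le s x /andP[s0 sL] /andP[x0 xL].
have ys : 0 <= y s by apply: (concave_ge0 h1 h2 y0 yL y2le); rewrite s0.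
have L0 := le_trans s0 sL.
case: (leP s x) => [sx|/ltW xs].
- have h := concave_chord h1 h2 y0 y2le s0 sx xL.
  rewrite mulrA; apply: (le_trans (y := x * y s * (L - s))).
    by rewrite ler_wpM2r // subr_ge0.
  rewrite mulrAC ler_wpM2r // expr2 ler_pM //; lra.
- have rL : is_deriv (fun s => L - s) (fun=> -1).
    apply: is_deriv_ext (is_derivB (is_deriv_cst L) is_deriv_id) _ => z /=.
    by ring.
  have hk1 := is_deriv_comp h1 rL.
  have hk2 := is_derivM (is_deriv_comp h2 rL) (is_deriv_cst (-1)).
  have y0' : y (L - 0) = 0 by rewrite subr0.
  have y2' (z : R) : 0 <= z <= L ->
      y2 (L - z) * -1 * -1 + y1 (L - z) * 0 <= 0.
    move=> /andP[z0 zL]; rewrite mulr0 addr0 -mulrA mulrNN !mulr1.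
    by apply: y2le; lra.
  have := concave_chord hk1 hk2 y0' y2' (s := L - s) (x := L - x).
  rewrite !subKr => h.
  have {}h : y x * (L - s) <= (L - x) * y s by apply: h; lra.
  rewrite [s * _]mulrC mulrA; apply: (le_trans (y := (L - x) * y s * s)).
    by rewrite ler_wpM2r.
  rewrite mulrAC ler_wpM2r // expr2 ler_pM //; lra.
Qed.

(** The constant comes from integrating the parabola of the previous lemma: the integral of
    [s (L - s)] over [[0, L]] is [L^3 / 6]. *)
Lemma concave_le_intR {R : realType} (L : R) (y y1 y2 : R -> R) :
  0 < L -> is_deriv y y1 -> is_deriv y1 y2 -> y 0 = 0 -> y L = 0 ->
  (forall x : R, 0 <= x <= L -> y2 x <= 0) ->
  forall x : R, 0 <= x <= L -> y x <= 6 / L * intR 0 L y.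
Proof.
move=> L0 h1 h2 y0 yL y2le x xL; have cy := is_deriv_continuous h1.
have [Y hY] := antiderivative_exists cy.
have hx2 := is_derivM (@is_deriv_id R) is_deriv_id.
have hx3 := is_derivM (@is_deriv_id R) hx2.
have h := is_derivB (is_derivZ (L ^+ 2) hY)
  (is_derivZ (y x) (is_derivB (is_derivZ (L / 2) hx2) (is_derivZ 3^-1 hx3))).
have := is_deriv_nondecr h _ (lexx 0) (ltW L0) (lexx L).
rewrite (intR_FTC (ltW L0) hY cy) => hb.
have : L ^+ 2 * (L * y x) <= L ^+ 2 * (6 * (Y L - Y 0)).
  have {hb} := hb _; rewrite -subr_ge0 => hb.
  rewrite -subr_ge0 -(pmulr_rge0 _ (_ : 0 < 6^-1)) ?invr_gt0 //.
  have -> : 6^-1 * (L ^+ 2 * (6 * (Y L - Y 0)) - L ^+ 2 * (L * y x)) =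
    L ^+ 2 * Y L - y x * (L / 2 * (L * L) - 3^-1 * (L * (L * L))) -
    (L ^+ 2 * Y 0 - y x * (L / 2 * (0 * 0) - 3^-1 * (0 * (0 * 0)))).
    by move: (Y L) (Y 0) (y x) => p q r; field.
  apply: hb => z zL.
  have -> : L ^+ 2 * y z - y x * (L / 2 * (1 * z + z * 1) -
      3^-1 * (1 * (z * z) + z * (1 * z + z * 1))) =
    L ^+ 2 * y z - y x * (z * (L - z)) by move: (y z) (y x) => p q; field.
  by rewrite subr_ge0; exact: (concave_above_parabola h1 h2 y0 yL y2le).
rewrite ler_pM2l ?exprn_gt0 // => hL.
by rewrite mulrAC ler_pdivlMr // mulrC.
Qed.

(** A second integration leaves [d'' - M d - F = k x] with [k] constant; evaluation at [L], where
    all three terms on the left vanish, gives [k = 0]. *)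
Lemma lin_sol_d2E {R : realType} (L M : R) (E F d : R -> R) :
  0 < L -> lin_sol L M 0 E d -> is_deriv F E -> F 0 = 0 -> F L = 0 ->
  forall x : R, 0 <= x <= L -> d2 d x = M * d x + F x.
Proof.
move=> L0 [[h1 h2 h3] [d0 [dL [d20 d2L]]] e] hF F0 FL.
pose k := d3 d 0 - M * d1 d 0 - E 0.
have hf := is_derivB (is_derivB (is_derivB h3 (is_derivZ M h1)) hF)
  (is_derivZ k is_deriv_id).
have fE := is_deriv_eq0 (a := 0) (b := L) hf.
have {}fE (x : R) : 0 <= x <= L -> d2 d x - M * d x - F x = k * x.
  move=> xL; have := fE _ x xL; rewrite d20 d0 F0 !mulr0 !subr0.
  move=> h; apply/eqP; rewrite -subr_eq0; apply/eqP; apply: h => z zL.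
  have := e z zL; rewrite /k mul0r mul0r subr0.
  move: (d3 d z) (d3 d 0) (d1 d z) (d1 d 0) (E z) (E 0) => a b c u v w.
  by move/(canRL (subrK _)) => ->; ring.
have k0 : k = 0.
  have := fE L; rewrite lexx (ltW L0) d2L dL FL mulr0 !subr0 => /(_ isT)/esym/eqP.
  by rewrite mulf_eq0 (gt_eqF L0) orbF => /eqP.
move=> x xL; have /eqP := fE x xL; rewrite k0 mul0r.
by rewrite -addrA -opprD subr_eq0 => /eqP.
Qed.

(* The difference [d = v - w] solves [d'''' = (a + b W) d'' + D (c - b v'')]
   with [D = W - V >= 0]. *)
Lemma sol_antitone {R : realType} (L a b c : R) (P v w : R -> R) :
  0 < L -> 0 < a -> 0 < b -> 0 < c ->
  lin_sol L (a + b * intR 0 L v) c P v -> lin_sol L (a + b * intR 0 L w) c P w ->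
  (forall x : R, 0 <= x <= L -> d2 v x <= 0) ->
  0 <= intR 0 L w -> intR 0 L v <= intR 0 L w ->
  forall x : R, 0 <= x <= L -> w x <= v x.
Proof.
move=> L0 a0 b0 c0 [Cv [v0 [vL [v20 v2L]]] ev] [Cw [w0 [wL [w20 w2L]]] ew].
set V := intR 0 L v in ev *; set W := intR 0 L w in ew * => v2 W0 VW x xL.
have [Cd e1 e2 e3] := C3_lincomb 1 (-1) Cv Cw.
have M0 : 0 < a + b * W by rewrite ltr_pwDl // mulr_ge0 // ltW.
have [_ hv2 _] := Cv.
have hG := is_derivZ (W - V) (is_derivB (is_derivZ c is_deriv_id) (is_derivZ b hv2)).
have Gm : nondecr_on L (fun x => (W - V) * (c * x - b * d1 v x)).
  apply: (is_deriv_nondecr hG) => z zL; rewrite mulr_ge0 ?subr_ge0 //.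
  rewrite mulr1; apply: (le_trans (y := 0)); last exact: ltW.
  by rewrite mulr_ge0_le0 ?v2 // ltW.
have dS : lin_sol L (a + b * W) 0 (fun x => (W - V) * (c * x - b * d1 v x))
    (fun x => 1 * v x + -1 * w x).
  split; first exact: Cd.
    by rewrite /nav_bc e2 v0 vL v20 v2L w0 wL w20 w2L !mulr0 !addr0.
  move=> z zL; rewrite e1 e3; have := ev z zL; have := ew z zL.
  move: (d3 v z) (d3 v 0) (d3 w z) (d3 w 0) (d1 v z) (d1 v 0) (d1 w z) (d1 w 0).
  move: (P z) (P 0) => p p0 p1 p2 p3 p4 p5 p6 p7 p8.
  move=> /(canRL (subrK _)) -> /(canRL (subrK _)) ->.
  by ring.
have := lin_sol_ge0 L0 M0 (lexx 0) (small_coupling0 _ _) Gm dS xL.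
by rewrite mul1r mulN1r subr_ge0.
Qed.

(** The order [w <= v] obtained from [sol_antitone] gives the opposite inequality between the
    integrals, so that lemma applies again with the roles exchanged. *)
Lemma sol_unique {R : realType} (L a b c : R) (P v w : R -> R) :
  0 < L -> 0 < a -> 0 < b -> 0 < c ->
  lin_sol L (a + b * intR 0 L v) c P v -> lin_sol L (a + b * intR 0 L w) c P w ->
  (forall x : R, 0 <= x <= L -> d2 v x <= 0) ->
  (forall x : R, 0 <= x <= L -> d2 w x <= 0) ->
  forall x : R, 0 <= x <= L -> v x = w x.
Proof.
wlog vw : v w / intR 0 L v <= intR 0 L w.
  move=> H L0 a0 b0 c0 hv hw v2 w2 x xL.
  case: (leP (intR 0 L v) (intR 0 L w)) => [vw|/ltW wv].
    exact: (H v w).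
  by apply/esym; apply: (H w v).
move=> L0 a0 b0 c0 hv hw v2 w2 x xL.
have I0 (z : R -> R) (A : R) : lin_sol L A c P z ->
    (forall x : R, 0 <= x <= L -> d2 z x <= 0) -> 0 <= intR 0 L z.
  move=> [Cz [z0 [zL _]] _] z2; have [h1 h2 _] := Cz.
  have c0' : continuous (fun _ : R => 0 : R).
    exact: is_deriv_continuous (is_deriv_cst _).
  have := intR_le (ltW L0) c0' (C3_continuous Cz) (concave_ge0 h1 h2 z0 zL z2).
  by rewrite (intR_FTC (ltW L0) (is_deriv_cst 0) c0') subrr.
have wv := sol_antitone L0 a0 b0 c0 hv hw v2 (I0 _ _ hw w2) vw.
have [Cv Cw] : C3 v /\ C3 w by case: hv; case: hw.
have eI : intR 0 L w <= intR 0 L v.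
  exact: intR_le (ltW L0) (C3_continuous Cw) (C3_continuous Cv) wv.
have vw' := sol_antitone L0 a0 b0 c0 hw hv w2 (I0 _ _ hv v2) eI.
by apply/le_anti; rewrite wv // vw'.
Qed.

(** * The order interval below phi *)

Definition cone_le {R : realType} (L : R) (u v : R -> R) : Prop :=
  forall x : R, 0 <= x <= L -> u x <= v x /\ d2 v x <= d2 u x.

Lemma phi_C3 {R : realType} (L lam : R) :
  [/\ C3 (phi L lam), d1 (phi L lam) = (fun x => lam * (pi / L) * cos (pi / L * x)),
      d2 (phi L lam) = (fun x => - (lam * (pi / L) ^+ 2) * sin (pi / L * x))
    & d3 (phi L lam) = (fun x => - (lam * (pi / L) ^+ 3) * cos (pi / L * x))].
Proof.
set w := pi / L.
have hs : is_deriv (fun x => sin (w * x)) (fun x => w * cos (w * x)).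
  apply: is_deriv_ext (is_deriv_comp (fun x => is_derive_sin x)
    (is_derivZ w is_deriv_id)) _ => x /=; ring.
have hc : is_deriv (fun x => cos (w * x)) (fun x => - (w * sin (w * x))).
  apply: is_deriv_ext (is_deriv_comp (fun x => is_derive_cos x)
    (is_derivZ w is_deriv_id)) _ => x /=; ring.
apply: is_deriv_C3.
- by apply: is_deriv_ext (is_derivZ lam hs) _ => x /=; ring.
- by apply: is_deriv_ext (is_derivZ _ hc) _ => x /=; ring.
- by apply: is_deriv_ext (is_derivZ _ hs) _ => x /=; ring.
Qed.

Lemma phi0 {R : realType} (L lam : R) : phi L lam 0 = 0.
Proof. by rewrite /phi mulr0 sin0 mulr0. Qed.

Lemma phiL {R : realType} (L lam : R) : L != 0 -> phi L lam L = 0.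
Proof. by move=> L0; rewrite /phi divfK // sinpi mulr0. Qed.

Lemma phi_nav_bc {R : realType} (L lam : R) : L != 0 -> nav_bc L (phi L lam).
Proof.
move=> L0; have [_ _ e2 _] := phi_C3 L lam.
by rewrite /nav_bc e2 phi0 phiL // mulr0 sin0 divfK // sinpi !mulr0.
Qed.

Lemma sin_itv_ge0 {R : realType} (L x : R) :
  0 < L -> 0 <= x <= L -> 0 <= sin (pi / L * x).
Proof.
move=> L0 /andP[x0 xL]; apply: sin_ge0_pi; apply/andP; split.
  by rewrite mulr_ge0 // divr_ge0 ?pi_ge0 // ltW.
by rewrite mulrAC ler_pdivrMr // ler_wpM2l // pi_ge0.
Qed.

Lemma intR_phi {R : realType} (L lam : R) :
  0 < L -> intR 0 L (phi L lam) = 2 * lam * L / pi.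
Proof.
move=> L0; have LN0 := lt0r_neq0 L0; have piN0 := lt0r_neq0 (pi_gt0 R).
have hc : is_deriv (fun x => - (lam * L / pi) * cos (pi / L * x)) (phi L lam).
  have h := is_derivZ (- (lam * L / pi)) (is_deriv_comp
    (fun x => is_derive_cos x) (is_derivZ (pi / L) (@is_deriv_id R))).
  apply: is_deriv_ext h _ => x /=; rewrite /phi; move: (sin _) => s.
  by move: (pi : R) piN0 => q qN0; field; rewrite LN0.
have [[h1 _ _] _ _ _] := phi_C3 L lam.
rewrite (intR_FTC (ltW L0) hc (is_deriv_continuous h1)).
rewrite divfK // mulr0 cospi cos0.
by move: (pi : R) piN0 => q qN0; field.
Qed.

Lemma zero_C3 {R : realType} :
  [/\ C3 (fun _ : R => 0 : R), d1 (fun _ : R => 0 : R) = (fun=> 0),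
      d2 (fun _ : R => 0 : R) = (fun=> 0) & d3 (fun _ : R => 0 : R) = (fun=> 0)].
Proof. by apply: is_deriv_C3; exact: is_deriv_cst. Qed.

Lemma C3_C2 {R : realType} (u : R -> R) : C3 u -> C2 u.
Proof.
move=> [h1 h2 h3]; split; [|split].
- by move=> x; exact: is_deriv_derivable h1.
- by move=> x; exact: is_deriv_derivable h2.
- exact: is_deriv_continuous h3.
Qed.

Lemma C2_is_deriv {R : realType} (u : R -> R) :
  C2 u -> is_deriv u (d1 u) /\ is_deriv (d1 u) (d2 u).
Proof. by move=> [D1 [D2 _]]; split; exact: derivable_is_deriv. Qed.

Lemma C2_continuous {R : realType} (u : R -> R) : C2 u -> continuous u.
Proof. by move=> /C2_is_deriv[/is_deriv_continuous]. Qed.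

Lemma d2_phi_bounds {R : realType} (L lam x : R) :
  0 < L -> 0 <= lam -> 0 <= x <= L ->
  - (lam * pi ^+ 2 / L ^+ 2) <= d2 (phi L lam) x <= 0.
Proof.
move=> L0 lam0 xL; have [_ _ -> _] := phi_C3 L lam.
have s0 := sin_itv_ge0 L0 xL; have s1 := sin_le1 (pi / L * x).
have -> : lam * pi ^+ 2 / L ^+ 2 = lam * (pi / L) ^+ 2 by rewrite exprMn exprVn -mulrA.
have k0 : 0 <= lam * (pi / L) ^+ 2 by rewrite mulr_ge0 // sqr_ge0.
move: (sin _) s0 s1 (lam * _) k0 => s s0 s1 k k0.
rewrite mulNr; apply/andP; split; last by rewrite oppr_le0 mulr_ge0.
by rewrite lerN2 ler_piMr.
Qed.

Lemma phi_bounds {R : realType} (L lam x : R) :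
  0 < L -> 0 <= lam -> 0 <= x <= L -> 0 <= phi L lam x <= lam.
Proof.
move=> L0 lam0 xL; have s0 := sin_itv_ge0 L0 xL.
by rewrite mulr_ge0 //= ler_piMr // sin_le1.
Qed.

Lemma setS_phi {R : realType} (L lam : R) :
  0 < L -> 0 <= lam -> setS L lam (phi L lam).
Proof.
move=> L0 lam0; have [C _ _ _] := phi_C3 L lam; split; first exact: C3_C2.
move=> x xL; have /andP[h _] := phi_bounds L0 lam0 xL.
have /andP[_ h2] := d2_phi_bounds L0 lam0 xL.
by rewrite h h2 !lexx.
Qed.

Lemma setS_zero {R : realType} (L lam : R) :
  0 < L -> 0 <= lam -> setS L lam (fun=> 0).
Proof.
move=> L0 lam0; have [C _ e2 _] := @zero_C3 R; split; first exact: C3_C2.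
move=> x xL; have /andP[h _] := phi_bounds L0 lam0 xL.
have /andP[_ h2] := d2_phi_bounds L0 lam0 xL.
by rewrite e2 h h2 !lexx.
Qed.

Lemma setS_ends {R : realType} (L lam : R) (u : R -> R) :
  0 < L -> setS L lam u -> u 0 = 0 /\ u L = 0.
Proof.
move=> L0 [_ h]; split; apply/le_anti.
- by have [] := h 0; rewrite ?lexx ?(ltW L0) // phi0 andbC.
- by have [] := h L; rewrite ?lexx ?(ltW L0) // phiL ?lt0r_neq0 // andbC.
Qed.

Lemma intR_cst0 {R : realType} (L : R) : 0 <= L -> intR 0 L (fun=> 0) = 0.
Proof.
move=> L0; have c0 := is_deriv_continuous (@is_deriv_cst R 0).
by rewrite (intR_FTC L0 (is_deriv_cst 0) c0) subrr.
Qed.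

Lemma setS_intR {R : realType} (L lam : R) (u : R -> R) :
  0 < L -> setS L lam u -> 0 <= intR 0 L u <= 2 * lam * L / pi.
Proof.
move=> L0 [C h]; have cu := C2_continuous C.
have c0 := is_deriv_continuous (@is_deriv_cst R 0).
have [[h1 _ _] _ _ _] := phi_C3 L lam.
rewrite -(intR_phi lam L0) -{1}(intR_cst0 (ltW L0)); apply/andP; split.
- apply: (intR_le (ltW L0) c0 cu) => x /h[/andP[]] //.
- by apply: (intR_le (ltW L0) cu (is_deriv_continuous h1)) => x /h[/andP[]].
Qed.

(** * The iteration *)

Lemma sigmaR_small_coupling {R : realType} (L M N : R) :
  0 < L -> 0 < M -> 0 < N ->
  N <= 4 * M / L ^+ 3 * sigmaR (Num.sqrt M * L) -> small_coupling L M N.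
Proof.
move=> L0 M0 N0; rewrite /sigmaR /small_coupling.
have m0 : 0 < Num.sqrt M by rewrite sqrtr_gt0.
have MM : M = Num.sqrt M ^+ 2 by rewrite sqr_sqrtr // ltW.
rewrite {1}MM; move: (Num.sqrt M) m0 => m m0.
set D := _ - (m * L) ^+ 3 => h.
have k0 : 0 < 4 * m ^+ 2 / L ^+ 3 * (3 * (m * L) ^+ 3).
  by rewrite !mulr_gt0 ?invr_gt0 ?exprn_gt0 // mulr_gt0.
(* The bound itself forces this: [N] is positive and lies below a positive factor divided by [D]. *)
have D0 : 0 < D.
  have := lt_le_trans N0 h; rewrite mulrA pmulr_rgt0 ?invr_gt0 //.
apply: le_trans (_ : 4 * m ^+ 2 / L ^+ 3 * (3 * (m * L) ^+ 3 / D) * D <= _).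
  by rewrite ler_pM2r.
rewrite -mulrA divfK ?lt0r_neq0 // le_eqVlt; apply/orP; left; apply/eqP.
by field; exact: lt0r_neq0.
Qed.

Lemma nondecr_on_sub_primitive {R : realType} (L : R) (F f p P : R -> R) :
  is_deriv F f -> continuous f ->
  (@lebesgue_measure R).-integrable `[0, L] (EFin \o p) ->
  (forall x : R, 0 <= x <= L -> P x = intR 0 x p) ->
  (\forall x \ae (@lebesgue_measure R), `[0, L]%classic x -> p x <= f x) ->
  nondecr_on L (fun x => F x - P x).
Proof.
move=> hF cf hp PE pf.
have hq : (@lebesgue_measure R).-integrable `[0, L] (EFin \o (fun x => - 1 * p x)).
  exact: (integrableZl _ (-1) hp).
have [hi hE] := integrable_add_continuous hF cf hq.
have pos : \forall x \ae (@lebesgue_measure R),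
    `[0, L]%classic x -> 0 <= f x + -1 * p x.
  by apply: ae_imp pf _ => x h /h; rewrite mulN1r subr_ge0.
have E x : 0 <= x <= L ->
    F x - P x = intR 0 x (fun x => f x + -1 * p x) + F 0.
  move=> xL; rewrite (hE x xL) (PE x xL) /intR RintegralZl //; first by ring.
  by case/andP: xL => x0 xL; exact: integrable_subitv hp _ _.
move=> s t s0 st tL; rewrite !E ?s0 ?tL ?(le_trans s0 st) ?(le_trans st tL) //.
by rewrite lerD2r; exact: (intR_nondecr hi pos).
Qed.

Lemma nondecr_on_add_deriv {R : realType} (L : R) (F f P : R -> R) :
  nondecr_on L P -> is_deriv F f -> (forall x : R, 0 <= x <= L -> 0 <= f x) ->
  nondecr_on L (fun x => P x + F x).
Proof.
move=> Pm hF f0 s t s0 st tL.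
by apply: lerD; [exact: Pm|exact: (is_deriv_nondecr hF f0)].
Qed.

Lemma le0_of_small {R : realType} (X C : R) :
  0 <= C -> (forall e : R, 0 < e -> X <= C * e) -> X <= 0.
Proof.
move=> C0 h; rewrite leNgt; apply/negP => X0.
have C1 : 0 < 2 * (C + 1) by rewrite mulr_gt0 // ltr_wpDl.
have e0 : 0 < X / (2 * (C + 1)) by exact: divr_gt0.
have XE : X / (2 * (C + 1)) * (2 * (C + 1)) = X by rewrite divfK // lt0r_neq0.
have := h _ e0; rewrite -[X in X <= _]XE; move: (X / _) e0 => e e0; nra.
Qed.

Lemma intR_dist {R : realType} (L e : R) (f g : R -> R) :
  0 <= L -> continuous f -> continuous g ->
  (forall x : R, 0 <= x <= L -> `|f x - g x| <= e) ->
  `|intR 0 L f - intR 0 L g| <= L * e.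
Proof.
move=> L0 cf cg fg.
have c1 := is_deriv_continuous (@is_deriv_cst R 1).
have I1 : intR 0 L (fun _ : R => 1 : R) = L.
  by rewrite (intR_FTC L0 is_deriv_id c1) subr0.
have le (u v : R -> R) : continuous u -> continuous v ->
    (forall x : R, 0 <= x <= L -> u x <= 1 * v x + e * 1) ->
    intR 0 L u <= intR 0 L v + e * L.
  move=> cu cv uv; have := intR_le L0 cu (continuous_lincomb (k := 1) (l := e) cv c1) uv.
  by rewrite (intR_lincomb _ _ L0 cv c1) I1 mul1r.
have fle : intR 0 L f <= intR 0 L g + e * L.
  apply: le => // x /fg; rewrite ler_norml => /andP[_].
  by rewrite mul1r mulr1 lerBlDl.
have gle : intR 0 L g <= intR 0 L f + e * L.
  apply: le => // x /fg; rewrite distrC ler_norml => /andP[_].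
  by rewrite mul1r mulr1 lerBlDl.
rewrite ler_norml [L * e]mulrC lerBlDl fle andbT lerNl opprB lerBlDl.
exact: gle.
Qed.

(** [v - u] is concave and vanishes at both ends, so its values are controlled by its integral. *)
Lemma cone_dist {R : realType} (L lam : R) (u v : R -> R) :
  0 < L -> setS L lam u -> setS L lam v -> cone_le L u v ->
  forall x : R, 0 <= x <= L ->
    `|v x - u x| <= 6 / L * `|intR 0 L v - intR 0 L u|.
Proof.
move=> L0 Su Sv uv x xL.
have [[Cu _] [Cv _]] := (Su, Sv).
have [[hu1 hu2] [hv1 hv2]] := (C2_is_deriv Cu, C2_is_deriv Cv).
have [[u0 uL] [v0 vL]] := (setS_ends L0 Su, setS_ends L0 Sv).
have hd1 := is_derivD (is_derivZ 1 hv1) (is_derivZ (-1) hu1).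
have hd2 := is_derivD (is_derivZ 1 hv2) (is_derivZ (-1) hu2).
have := concave_le_intR L0 hd1 hd2.
rewrite (intR_lincomb _ _ (ltW L0) (C2_continuous Cv) (C2_continuous Cu)).
rewrite u0 uL v0 vL !mulr0 addr0 => h.
have [ux _] := uv x xL.
rewrite ger0_norm ?subr_ge0 //; have := h erefl erefl _ x xL.
rewrite !mul1r !mulN1r => {}h; apply: le_trans (h _) _.
  by move=> z /uv[_ d]; rewrite mul1r mulN1r subr_le0.
by rewrite ler_wpM2l ?ler_norm // divr_ge0 // ltW.
Qed.

Lemma bounded_nondecr_cvg {R : realType} (I : nat -> R) (B : R) :
  (forall n, I n <= I n.+1) -> (forall n, I n <= B) ->
  exists l : R, forall eta : R, 0 < eta -> exists n0, forall n, (n0 <= n)%N ->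
    `|I n - l| <= eta.
Proof.
move=> Im IB.
have nd : nondecreasing_seq I by apply/nondecreasing_seqP.
have ub : has_ubound (range I) by exists B => _ [n _ <-].
exists (sup (range I)) => eta eta0.
have := nondecreasing_cvgn nd ub => /cvgrPdist_le /(_ eta eta0)[n0 _ h].
by exists n0 => n nn; rewrite distrC; exact: h.
Qed.

Section Iteration.
Variables (R : realType) (L a b c lam : R) (p P : R -> R).
Let Lam : R := 2 * lam * L / pi.
Let kap : R := lam * pi ^+ 2 / L ^+ 2.
Let M : R := a + b * Lam.
Let N : R := c + b * kap.

Hypotheses (L0 : 0 < L) (a0 : 0 < a) (b0 : 0 < b) (c0 : 0 < c) (lam0 : 0 < lam).
Hypothesis p_int : (@lebesgue_measure R).-integrable `[0, L] (EFin \o p).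
Hypothesis p_ge0 :
  \forall x \ae (@lebesgue_measure R), `[0, L]%classic x -> 0 <= p x.
Hypothesis p_ub :
  \forall x \ae (@lebesgue_measure R), `[0, L]%classic x ->
     p x <= (lam * pi ^+ 4 / L ^+ 4 + a * lam * pi ^+ 2 / L ^+ 2
             + 2 * b * lam ^+ 2 * pi / L) * sin (pi / L * x)
            + 2 * lam * c * L / pi.
Hypothesis N_ub :
  c + b * lam * pi ^+ 2 / L ^+ 2 <=
    4 * (a + 2 * b * lam * L / pi) / L ^+ 3 *
      sigmaR (Num.sqrt (a + 2 * b * lam * L / pi) * L).
Hypothesis P_cont : continuous P.
Hypothesis P_prim : forall x : R, 0 <= x <= L -> P x = intR 0 x p.

(* The primitive of the right-hand side of the iteration with previous
   iterate [z]. *)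
Definition load (z : R -> R) (x : R) : R :=
  P x + (b * (intR 0 L z - Lam) * d1 z x + b * kap * intR 0 L z * x).

Let ME : a + 2 * b * lam * L / pi = M.
Proof. by rewrite /M /Lam; move: (pi : R)^-1 => q; ring. Qed.

Let NE : c + b * lam * pi ^+ 2 / L ^+ 2 = N.
Proof. by rewrite /N /kap !mulrA. Qed.

Let Lam0 : 0 < Lam.
Proof. by rewrite divr_gt0 ?pi_gt0 // mulr_gt0 // mulr_gt0. Qed.

Let kap0 : 0 < kap.
Proof. by rewrite divr_gt0 ?exprn_gt0 // mulr_gt0 // exprn_gt0 // pi_gt0. Qed.

Let M0 : 0 < M. Proof. by rewrite addr_gt0 // mulr_gt0. Qed.
Let N0 : 0 < N. Proof. by rewrite addr_gt0 // mulr_gt0. Qed.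

Let smallMN : small_coupling L M N.
Proof. by apply: sigmaR_small_coupling => //; rewrite -ME -NE. Qed.

Let P_nondecr : nondecr_on L P.
Proof.
move=> s t s0 st tL; rewrite !P_prim ?s0 ?tL ?(le_trans s0 st) ?(le_trans st tL) //.
exact: (intR_nondecr p_int p_ge0).
Qed.

Lemma setS_d2_ge (z : R -> R) (x : R) :
  setS L lam z -> 0 <= x <= L -> - kap <= d2 z x <= 0.
Proof.
move=> [_ h] xL; have [_ /andP[h1 ->]] := h x xL; rewrite andbT.
by apply: le_trans _ h1; have /andP[] := d2_phi_bounds L0 (ltW lam0) xL.
Qed.

Lemma is_deriv_load (z : R -> R) : C2 z ->
  is_deriv (fun x => b * (intR 0 L z - Lam) * d1 z x + b * kap * intR 0 L z * x)
           (fun x => b * (intR 0 L z - Lam) * d2 z x + b * kap * intR 0 L z).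
Proof.
move=> /C2_is_deriv[_ h2].
have h := is_derivD (is_derivZ (b * (intR 0 L z - Lam)) h2)
  (is_derivZ (b * kap * intR 0 L z) is_deriv_id).
by apply: is_deriv_ext h _ => x /=; rewrite mulr1.
Qed.

Lemma iter_stepP (z y : R -> R) : C2 z ->
  iter_step L a b c lam p z y <-> lin_sol L M N (load z) y.
Proof.
move=> Cz; rewrite /iter_step /= ME NE.
have cd : continuous (fun x => b * (intR 0 L z - Lam) * d2 z x
    + b * kap * intR 0 L z).
  move=> x; apply: cvgD; last exact: cvg_cst.
  by apply: cvgMr; case: Cz => _ [_]; apply.
have [hi hE] := integrable_add_continuous (is_deriv_load Cz) cd p_int.
have e : (fun x => b * (intR 0 L z - Lam) * d2 z x + b * kap * intR 0 L z + p x) =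
  (fun x => p x + b * d2 z x * intR 0 L z - 2 * b * lam * (L / pi) * d2 z x
            + b * lam * (pi ^+ 2 / L ^+ 2) * intR 0 L z).
  apply/funext => x; rewrite /Lam /kap.
  by move: (d2 z x) (intR 0 L z) (p x) (pi : R)^-1 (pi : R) (L ^+ 2)^-1 => *; ring.
apply: (W41_lin_sol M N y L0).
  by rewrite -e.
move=> x xL; rewrite -e (hE x xL) /load -(P_prim xL).
rewrite [P 0]P_prim ?lexx ?(ltW L0) //.
rewrite (_ : intR 0 0 p = 0); last by rewrite /intR set_itv1 Rintegral_set1.
by move: (d1 z x) (d1 z 0) (intR 0 L z) => d d' Z; ring.
Qed.

Lemma step_exists (z : R -> R) : C2 z -> exists y, iter_step L a b c lam p z y.
Proof.
move=> Cz.
have cl : continuous (load z).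
  move=> x; apply: cvgD; first exact: P_cont.
  exact: (is_deriv_continuous (is_deriv_load Cz)).
have [y yS] := lin_sol_exists L0 M0 (ltW N0) cl.
by exists y; apply/(iter_stepP _ Cz).
Qed.

(* [load v - load u] has derivative
   [b (V - Lam) (v'' - u'') + b (V - U) (u'' + kap)]. *)
Lemma step_le (u v u' v' : R -> R) :
  setS L lam u -> setS L lam v -> cone_le L u v ->
  iter_step L a b c lam p u u' -> iter_step L a b c lam p v v' ->
  cone_le L u' v'.
Proof.
move=> Su Sv uv.
have [Cu Cv] : C2 u /\ C2 v by case: Su; case: Sv.
move=> /(iter_stepP _ Cu) hu /(iter_stepP _ Cv) hv.
have UV : intR 0 L u <= intR 0 L v.
  by apply: intR_le (ltW L0) (C2_continuous Cu) (C2_continuous Cv) _ => x /uv[].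
have /andP[_ VL] := setS_intR L0 Sv.
have dl := is_derivB (is_deriv_load Cv) (is_deriv_load Cu).
apply: (lin_sol_le L0 M0 (ltW N0) smallMN _ hu hv) => s t s0 st tL.
have E x : load v x - load u x =
    b * (intR 0 L v - Lam) * d1 v x + b * kap * intR 0 L v * x -
    (b * (intR 0 L u - Lam) * d1 u x + b * kap * intR 0 L u * x).
  by rewrite /load opprD addrACA subrr add0r.
rewrite !E; apply: (is_deriv_nondecr dl _ s0 st tL).
have pos x : 0 <= x <= L -> 0 <=
  b * (intR 0 L v - Lam) * d2 v x + b * kap * intR 0 L v -
  (b * (intR 0 L u - Lam) * d2 u x + b * kap * intR 0 L u).
  move=> xL; have [_ d2le] := uv x xL; have /andP[u2 _] := setS_d2_ge Su xL.
  move: (d2 u x) (d2 v x) (intR 0 L u) (intR 0 L v) d2le u2 UV VL.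
  rewrite -/Lam => p1 p2 U V d2le u2 UV VL.
  have -> : b * (V - Lam) * p2 + b * kap * V - (b * (U - Lam) * p1 + b * kap * U)
     = b * ((Lam - V) * (p1 - p2) + (V - U) * (p1 + kap)) by ring.
  rewrite mulr_ge0 ?(ltW b0) // addr_ge0 // mulr_ge0 ?subr_ge0 //.
  by rewrite -lerBlDr sub0r.
exact: pos.
Qed.

(** The load is nonnegative because [intR 0 L z - Lam] and [z''] are both nonpositive. For the upper
    bounds, [phi] is compared with [y] as the solution for a larger load. *)
Lemma step_setS (z y : R -> R) :
  setS L lam z -> iter_step L a b c lam p z y -> setS L lam y.
Proof.
move=> Sz; have Cz : C2 z by case: Sz.
move=> /(iter_stepP _ Cz) hy.
have /andP[Z0 ZL] := setS_intR L0 Sz; rewrite -/Lam in ZL.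
have lm : nondecr_on L (load z).
  apply: (nondecr_on_add_deriv P_nondecr (is_deriv_load Cz)) => x xL.
  have /andP[_ z2] := setS_d2_ge Sz xL.
  apply: addr_ge0; last by rewrite mulr_ge0 // mulr_ge0 // ltW.
  by rewrite mulr_le0 // mulr_ge0_le0 ?subr_le0 // ltW.
have d2le := lin_sol_d2_le0 L0 M0 (ltW N0) smallMN lm hy.
have yge := lin_sol_ge0 L0 M0 (ltW N0) smallMN lm hy.
have [Cphi e1 e2 e3] := phi_C3 L lam.
(* The load for which [phi] is an exact solution, its integral being [Lam]. *)
pose H x := d3 (phi L lam) x - M * d1 (phi L lam) x + N * Lam * x.
have hphi : lin_sol L M N H (phi L lam).
  split; [exact: Cphi|exact: (phi_nav_bc _ (lt0r_neq0 L0))|] => x _.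
  rewrite (intR_phi lam L0) -/Lam /H.
  by move: (d3 _ x) (d3 _ 0) (d1 _ x) (d1 _ 0) => p1 p2 p3 p4; ring.
pose w : R := pi / L.
(* With this [A], [A sin (w x) + c Lam] is the assumed upper bound on [p]. The rest of the
   derivative of [H], the constant [b kap Lam], exceeds the part of the load depending on [z] by
   [b (Lam - Z) (z'' + kap) >= 0]. *)
pose A : R := lam * w ^+ 4 + M * lam * w ^+ 2.
have hF : is_deriv (fun x => - (lam * w ^+ 3 + M * lam * w) * cos (w * x)
      + c * Lam * x) (fun x => A * sin (w * x) + c * Lam).
  have hc := is_deriv_comp (fun x => is_derive_cos x) (is_derivZ w (@is_deriv_id R)).
  have h := is_derivD (is_derivZ (- (lam * w ^+ 3 + M * lam * w)) hc)
    (is_derivZ (c * Lam) is_deriv_id).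
  by apply: is_deriv_ext h _ => x /=; rewrite /A; ring.
have cf : continuous (fun x => A * sin (w * x) + c * Lam).
  have hs := is_deriv_comp (fun x => is_derive_sin x) (is_derivZ w (@is_deriv_id R)).
  exact: (is_deriv_continuous (is_derivD (is_derivZ A hs) (is_deriv_cst (c * Lam)))).
have pf : \forall x \ae (@lebesgue_measure R), `[0, L]%classic x ->
    p x <= A * sin (w * x) + c * Lam.
  apply: ae_imp p_ub _ => x hx xL; apply: le_trans (hx xL) _.
  rewrite -/w le_eqVlt; apply/orP; left; apply/eqP.
  rewrite /A /M /Lam /w; move: (sin _) => s.
  by move: (pi : R) (lt0r_neq0 (pi_gt0 R)) => q qN0; field; rewrite qN0 (lt0r_neq0 L0).
have Hm := nondecr_on_sub_primitive hF cf p_int P_prim pf.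
have hz := is_derivB (is_derivZ (b * kap * Lam) is_deriv_id) (is_deriv_load Cz).
have mono : nondecr_on L (fun x => H x - load z x).
  have zpos x : 0 <= x <= L -> 0 <= b * kap * Lam * 1 -
      (b * (intR 0 L z - Lam) * d2 z x + b * kap * intR 0 L z).
    move=> xL; have /andP[z2 _] := setS_d2_ge Sz xL.
    move: (d2 z x) (intR 0 L z) z2 Z0 ZL => p1 Z z2 Z0 ZL.
    have -> : b * kap * Lam * 1 - (b * (Z - Lam) * p1 + b * kap * Z) =
      b * ((Lam - Z) * (p1 + kap)) by ring.
    rewrite mulr_ge0 ?(ltW b0) // mulr_ge0 ?subr_ge0 //.
    by rewrite -lerBlDr sub0r.
  have E x : H x - load z x = - (lam * w ^+ 3 + M * lam * w) * cos (w * x)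
      + c * Lam * x - P x + (b * kap * Lam * x - (b * (intR 0 L z - Lam) * d1 z x
      + b * kap * intR 0 L z * x)).
    rewrite /H /load e1 e3 -/w /N; move: (d1 z x) (intR 0 L z) (cos _) (P x).
    by move=> z1 Z cs Px; ring.
  move=> s t s0 st tL; rewrite !E.
  exact: (nondecr_on_add_deriv Hm hz zpos).
have cone := lin_sol_le L0 M0 (ltW N0) smallMN mono hy hphi.
split; first by case: hy => /C3_C2.
move=> x xL; have [yp p2] := cone x xL.
split; apply/andP; split; [exact: yge|exact: yp|exact: p2|exact: d2le].
Qed.

(** The three summands bound the three terms of [F] in [step_error]: the distance between
    consecutive iterates, the term in [z] with [|z| <= lam], and the constant part of the load
    weighted by [x (L - x) / 2]. *)
Let K : R := 12 * b * Lam / L + b * lam + (2 * b * kap + c) * L ^+ 2.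

Let K0 : 0 <= K.
Proof.
apply/ltW/addr_gt0; first apply: addr_gt0.
- by apply: divr_gt0 => //; apply: mulr_gt0 => //; apply: mulr_gt0.
- exact: mulr_gt0.
- apply: mulr_gt0; last exact: exprn_gt0.
  by apply: addr_gt0 => //; apply: mulr_gt0 => //; apply: mulr_gt0.
Qed.

(* [y - u] solves [d'' = (a + b I) d + F] where [F] measures how far the
   iteration is from being stationary. *)
Lemma step_error (z y u : R -> R) (I eta : R) :
  setS L lam z -> iter_step L a b c lam p z y -> 0 <= I <= Lam ->
  lin_sol L (a + b * I) 0 (fun x => P x - c * I * x) u ->
  `|intR 0 L z - I| <= eta -> `|intR 0 L y - I| <= eta ->
  (forall x : R, 0 <= x <= L ->
     `|y x - z x| <= 6 / L * `|intR 0 L y - intR 0 L z|) ->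
  forall x : R, 0 <= x <= L ->
    `|y x - u x| <= K * eta / a /\ `|d2 y x - d2 u x| <= 2 * (K * eta).
Proof.
move=> Sz step /andP[I0 IL] hu Ze Ye yz.
have Sy := step_setS Sz step; have Cz : C2 z by case: Sz.
move: step => /(iter_stepP _ Cz) hy.
have [Cy [y0 [yL [y20 y2L]]] ey] := hy.
have [Cu [u0 [uL [u20 u2L]]] eu] := hu.
have [z0 zL] := setS_ends L0 Sz.
have [Cd e1 e2 e3] := C3_lincomb 1 (-1) Cy Cu.
set Z := intR 0 L z in Ze yz *; set Y := intR 0 L y in ey Ye yz *.
have eta0 : 0 <= eta := le_trans (normr_ge0 _) Ze.
pose A := a + b * I.
have A0 : 0 < A by rewrite ltr_pwDl // mulr_ge0 // ltW.
pose q := b * kap * (Z - Y) + c * (I - Y).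
(* [E] is a primitive of the residual load, whose constant part is [q], and [F] is the primitive of
   [E] vanishing at both ends. Only [y - z] and [z] occur in [F], and these are controlled
   uniformly. *)
pose E x := b * (Lam - I) * (d1 y x - d1 z x) + b * (Z - I) * d1 z x
            - q * (L / 2 - x).
pose F x := b * (Lam - I) * (y x - z x) + b * (Z - I) * z x
            - q * (x * (L - x) / 2).
have dS : lin_sol L A 0 E (fun x => 1 * y x + -1 * u x).
  split; first exact: Cd.
    by rewrite /nav_bc e2 y0 yL y20 y2L u0 uL u20 u2L !mulr0 !addr0.
  move=> x xL; rewrite e1 e3; have := ey x xL; have := eu x xL.
  rewrite /E /load /q /A /M /N -/Z.
  move: (d3 y x) (d3 y 0) (d3 u x) (d3 u 0) (d1 y x) (d1 y 0) (d1 u x) (d1 u 0).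
  move: (P x) (P 0) (d1 z x) (d1 z 0) => p1 p2 p3 p4 p5 p6 p7 p8 p9 q1 q2 q3.
  move=> /(canRL (subrK _)) -> /(canRL (subrK _)) ->.
  by field.
have [hy1 _ _] := Cy; have [hz1 _] := C2_is_deriv Cz.
have hF : is_deriv F E.
  exact: is_derivB (is_derivD (is_derivZ _ (is_derivB hy1 hz1))
    (is_derivZ _ hz1)) (is_derivZ q (is_deriv_bump L)).
have F0 : F 0 = 0 by rewrite /F y0 z0 !mul0r !mulr0 subrr !mulr0 addr0 subr0.
have FL : F L = 0.
  by rewrite /F yL zL !subrr !mulr0 !mul0r !mulr0 addr0 subr0.
have dE := lin_sol_d2E L0 dS hF F0 FL.
have FK x : 0 <= x <= L -> `|F x| <= K * eta.
  move=> xL; have YZ : `|Y - Z| <= 2 * eta.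
    have -> : Y - Z = (Y - I) - (Z - I) by ring.
    apply: le_trans (ler_normB _ _) _; rewrite mulr_natl mulr2n; exact: lerD.
  have zlam : `|z x| <= lam.
    have [_ /(_ x xL)[/andP[zx0 zxp] _]] := Sz.
    rewrite ger0_norm //; apply: le_trans zxp _.
    by have /andP[] := phi_bounds L0 (ltW lam0) xL.
  have bump : `|x * (L - x) / 2| <= L ^+ 2.
    move: xL => /andP[xx0 xL'].
    rewrite ger0_norm; last by rewrite divr_ge0 // mulr_ge0 // subr_ge0.
    rewrite ler_pdivrMr // expr2; apply: le_trans (_ : L * L <= _).
      by apply: ler_pM; rewrite ?subr_ge0 // gerBl.
    by apply: ler_peMr; [apply: mulr_ge0; exact: ltW|rewrite ler1n].
  have -> : K * eta = b * Lam * (6 / L * (2 * eta)) + b * eta * lam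
      + (b * kap * (2 * eta) + c * eta) * L ^+ 2.
    by rewrite /K; field; exact: lt0r_neq0.
  apply: le_trans (ler_normB _ _) _; apply: lerD.
    apply: le_trans (ler_normD _ _) _; apply: lerD.
    - rewrite normrM; apply: ler_pM => //.
        rewrite normrM (gtr0_norm b0) ler_pM2l //.
        by rewrite ger0_norm ?subr_ge0 // gerBl.
      apply: le_trans (yz x xL) _; rewrite ler_wpM2l //.
      by rewrite divr_ge0 // ltW.
    - rewrite normrM; apply: ler_pM => //.
      by rewrite normrM (gtr0_norm b0) ler_pM2l.
  rewrite normrM; apply: ler_pM => //.
  apply: le_trans (ler_normD _ _) _; apply: lerD.
  - have bk : 0 < b * kap := mulr_gt0 b0 kap0.
    by rewrite normrM (gtr0_norm bk) (ler_pM2l bk) distrC.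
  - by rewrite normrM (gtr0_norm c0) (ler_pM2l c0) distrC.
have [hd1 hd2 _] := Cd.
have d0 : 1 * y 0 + -1 * u 0 = 0 by rewrite y0 u0 !mulr0 addr0.
have dL : 1 * y L + -1 * u L = 0 by rewrite yL uL !mulr0 addr0.
have Ke : 0 <= K * eta by rewrite mulr_ge0.
have dB := second_order_bvp_bound A0 Ke hd1 hd2 d0 dL dE FK.
move=> x xL; split.
- have := dB x xL; rewrite mul1r mulN1r => h; apply: le_trans h _.
  by rewrite ler_wpM2l // lef_pV2 // /A lerDl mulr_ge0 // ltW.
- have := dE x xL; rewrite e2 !mul1r !mulN1r => ->.
  apply: le_trans (ler_normD _ _) _; rewrite mulr_natl mulr2n.
  apply: lerD; last exact: FK.
  rewrite normrM (gtr0_norm A0) mulrC -ler_pdivlMr //.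
  by have := dB x xL; rewrite mul1r mulN1r.
Qed.

Lemma iter_limit (y : nat -> R -> R) (I : R) :
  (forall n, setS L lam (y n)) ->
  (forall n, iter_step L a b c lam p (y n) (y n.+1)) ->
  (forall n (x : R), 0 <= x <= L ->
     `|y n.+1 x - y n x| <= 6 / L * `|intR 0 L (y n.+1) - intR 0 L (y n)|) ->
  (forall eta : R, 0 < eta -> exists n0, forall n, (n0 <= n)%N ->
     `|intR 0 L (y n) - I| <= eta) ->
  exists u, [/\ lin_sol L (a + b * intR 0 L u) c P u, setS L lam u
    & unif_cvg_on L y u].
Proof.
move=> Sy step yy yI.
have I0L : 0 <= I <= Lam.
  have h (eta : R) : 0 < eta -> - I <= 1 * eta /\ I - Lam <= 1 * eta.
    move=> /yI[n0 /(_ n0 (leqnn n0))]; have := setS_intR L0 (Sy n0).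
    rewrite -/Lam ler_norml => /andP[i0 iL] /andP[j0 jL].
    move: (intR 0 L (y n0)) i0 iL j0 jL => J i0 iL j0 jL.
    by rewrite mul1r; split; lra.
  rewrite -oppr_le0 -[I <= _]subr_le0; apply/andP; split.
  - by apply: (@le0_of_small _ _ 1) => // eta /h[].
  - by apply: (@le0_of_small _ _ 1) => // eta /h[].
have A0 : 0 < a + b * I.
  by case/andP: I0L => I0 _; rewrite ltr_pwDl // mulr_ge0 // ltW.
have cQ : continuous (fun x => P x - c * I * x).
  move=> x; apply: cvgB; first exact: P_cont.
  exact: (is_deriv_continuous (is_derivZ (c * I) is_deriv_id)).
have [u hu] := lin_sol_exists_uncoupled L0 A0 cQ.
have Cu : C3 u by case: hu.
(* The inequality [n0 < n] is strict because [step_error] estimates an iterate from the integrals of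
   that iterate and its predecessor. *)
have close (eta : R) : 0 < eta -> exists n0, forall n, (n0 < n)%N ->
    `|intR 0 L (y n) - I| <= eta /\ forall x : R, 0 <= x <= L ->
    `|y n x - u x| <= K * eta / a /\ `|d2 (y n) x - d2 u x| <= 2 * (K * eta).
  move=> /yI[n0 hn]; exists n0 => -[//|n] nn.
  have h1 := hn n nn; have h2 := hn n.+1 (leqW nn); split; first exact: h2.
  exact: (step_error (Sy n) (step n) I0L hu h1 h2 (yy n)).
have IU : intR 0 L u = I.
  have : `|intR 0 L u - I| <= 0.
    apply: (@le0_of_small _ _ (L * K / a + 1)).
      by rewrite addr_ge0 // divr_ge0 ?(ltW a0) // mulr_ge0 // ltW.
    move=> eta /close[n0 /(_ n0.+1 (leqnn _))[h1 h2]].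
    have h3 : `|intR 0 L (y n0.+1) - intR 0 L u| <= L * (K * eta / a).
      apply: (intR_dist (ltW L0) _ (C3_continuous Cu)); last by move=> x /h2[].
      by case: (Sy n0.+1) => /C2_continuous.
    have -> : intR 0 L u - I =
      (intR 0 L (y n0.+1) - I) - (intR 0 L (y n0.+1) - intR 0 L u) by ring.
    apply: le_trans (ler_normB _ _) _.
    have -> : (L * K / a + 1) * eta = eta + L * (K * eta / a) by ring.
    exact: lerD.
  by rewrite normr_le0 subr_eq0 => /eqP.
exists u; split.
- have [_ bc eu] := hu; split; [exact: Cu|exact: bc|] => x xL.
  rewrite (eu x xL) IU.
  by move: (d1 u x) (d1 u 0) => p1 p2; ring.
- split; first exact: C3_C2.
  have Ka : 0 <= K / a by rewrite divr_ge0 // ltW.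
  have K2 : 0 <= 2 * K by rewrite mulr_ge0.
  move=> x xL.
  have [b1 b2] : - u x <= 0 /\ u x - phi L lam x <= 0.
    split; apply: (le0_of_small Ka) => eta /close[n0 /(_ n0.+1 (leqnn _))[_ h]];
      have [+ _] := h x xL; have [_ /(_ x xL)[/andP[y0 yp] _]] := Sy n0.+1;
      rewrite ler_norml mulrAC => /andP[j1 j2].
    + by apply: le_trans j2; rewrite lerDr.
    + apply: le_trans (_ : u x - y n0.+1 x <= _); first by rewrite lerD2l lerN2.
      by rewrite lerNl opprB in j1.
  have [b3 b4] : d2 (phi L lam) x - d2 u x <= 0 /\ d2 u x <= 0.
    split; apply: (le0_of_small K2) => eta /close[n0 /(_ n0.+1 (leqnn _))[_ h]];
      have [_ +] := h x xL; have [_ /(_ x xL)[_ /andP[y0 yp]]] := Sy n0.+1;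
      rewrite ler_norml mulrA => /andP[j1 j2].
    + by apply: le_trans j2; rewrite lerD2r.
    + apply: le_trans (_ : d2 u x - d2 (y n0.+1) x <= _).
        by rewrite lerDl oppr_ge0.
      by rewrite lerNl opprB in j1.
  rewrite oppr_le0 in b1; rewrite subr_le0 in b2; rewrite subr_le0 in b3.
  by split; apply/andP; split; [exact: b1|exact: b2|exact: b3|exact: b4].
- move=> eps eps0.
  have K1 : 0 < K + 1 by rewrite ltr_wpDl.
  (* Dividing by [K + 1] instead of [K] makes the final estimate strictly smaller than [eps]. *)
  have eta0 : 0 < eps * a / (K + 1) by rewrite divr_gt0 // mulr_gt0.
  have [n0 hn] := close _ eta0; exists n0.+1 => n nn x xL.
  have [_ /(_ x xL)[h _]] := hn n nn; apply: le_lt_trans h _.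
  have -> : K * (eps * a / (K + 1)) / a = K * eps / (K + 1).
    by field; rewrite !lt0r_neq0.
  by rewrite ltr_pdivrMr // mulrC ltr_pM2l // ltrDl.
Qed.

(** * Iterative sequences and their common limit *)

Lemma iter_seq_exists (y0 : R -> R) :
  setS L lam y0 -> exists y, iter_seq L a b c lam p y0 y.
Proof.
move=> S0.
(* The choice of a successor must be total; outside the [C2] functions its value is arbitrary, and
   the iterates never leave the set. *)
have /choice[f hf] : forall z : R -> R, exists y,
    C2 z -> iter_step L a b c lam p z y.
  move=> z.
  have [Cz|nCz] := pselect (C2 z); last by exists z.
  by have [y hy] := step_exists Cz; exists y.
have Sn n : setS L lam (iter n f y0).
  by elim: n => [//|n IH]; apply: step_setS (IH) (hf _ _); case: IH.
by exists (fun n => iter n f y0); split=> // n; apply: hf; case: (Sn n).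
Qed.

Lemma iter_seq_setS (y0 : R -> R) (y : nat -> R -> R) :
  setS L lam y0 -> iter_seq L a b c lam p y0 y -> forall n, setS L lam (y n).
Proof.
move=> S0 [y0E step]; elim=> [|n IH]; first by rewrite y0E.
exact: step_setS IH (step n).
Qed.

Lemma iter_seq_le (u0 v0 : R -> R) (u v : nat -> R -> R) :
  setS L lam u0 -> setS L lam v0 -> cone_le L u0 v0 ->
  iter_seq L a b c lam p u0 u -> iter_seq L a b c lam p v0 v ->
  forall n, cone_le L (u n) (v n).
Proof.
move=> Su Sv uv hu hv.
have Sun := iter_seq_setS Su hu; have Svn := iter_seq_setS Sv hv.
case: hu hv => [u0E ustep] [v0E vstep].
elim=> [|n IH]; first by rewrite u0E v0E.
exact: step_le (Sun n) (Svn n) IH (ustep n) (vstep n).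
Qed.

Lemma setS_cone (u : R -> R) :
  setS L lam u -> cone_le L (fun=> 0) u /\ cone_le L u (phi L lam).
Proof.
move=> [_ h]; have [_ _ e2 _] := @zero_C3 R.
by split=> x /h[/andP[h1 h2] /andP[h3 h4]]; split; rewrite ?e2.
Qed.

(* The sequence shifted by one is again an iterative sequence. *)
Lemma iter_seq_shift_cmp (y0 : R -> R) (y : nat -> R -> R) :
  setS L lam y0 -> iter_seq L a b c lam p y0 y ->
  (cone_le L y0 (y 1%N) -> forall n, cone_le L (y n) (y n.+1)) /\
  (cone_le L (y 1%N) y0 -> forall n, cone_le L (y n.+1) (y n)).
Proof.
move=> S0 hy; have Sn := iter_seq_setS S0 hy.
have hy1 : iter_seq L a b c lam p (y 1%N) (fun n => y n.+1).
  by split=> // n; case: hy => _; apply.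
by split=> h; [exact: iter_seq_le S0 (Sn 1%N) h hy hy1
              |exact: iter_seq_le (Sn 1%N) S0 h hy1 hy].
Qed.

Lemma iter_limit_zero (y : nat -> R -> R) :
  iter_seq L a b c lam p (fun=> 0) y ->
  exists u, [/\ lin_sol L (a + b * intR 0 L u) c P u, setS L lam u
    & unif_cvg_on L y u].
Proof.
move=> hy; have S0 := setS_zero L0 (ltW lam0).
have Sn := iter_seq_setS S0 hy.
have [up _] := iter_seq_shift_cmp S0 hy.
have {}up := up (setS_cone (Sn 1%N)).1.
have [I hI] : exists I : R, forall eta : R, 0 < eta -> exists n0, forall n,
    (n0 <= n)%N -> `|intR 0 L (y n) - I| <= eta.
  apply: (bounded_nondecr_cvg (B := Lam)) => n.
    have [[C1 _] [C2' _]] := (Sn n, Sn n.+1).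
    apply: (intR_le (ltW L0) (C2_continuous C1) (C2_continuous C2')) => x xL.
    by have [] := up n x xL.
  by have /andP[] := setS_intR L0 (Sn n).
apply: (iter_limit Sn _ _ hI); first by case: hy.
by move=> n x xL; exact: (cone_dist L0 (Sn n) (Sn n.+1) (up n)).
Qed.

Lemma iter_limit_phi (y : nat -> R -> R) :
  iter_seq L a b c lam p (phi L lam) y ->
  exists u, [/\ lin_sol L (a + b * intR 0 L u) c P u, setS L lam u
    & unif_cvg_on L y u].
Proof.
move=> hy; have S0 := setS_phi L0 (ltW lam0).
have Sn := iter_seq_setS S0 hy.
have [_ dn] := iter_seq_shift_cmp S0 hy.
have {}dn := dn (setS_cone (Sn 1%N)).2.
(* The integrals now decrease, so the convergence lemma is applied to their negatives, bounded above
   by zero. *)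
have [I hI] : exists I : R, forall eta : R, 0 < eta -> exists n0, forall n,
    (n0 <= n)%N -> `|- intR 0 L (y n) - I| <= eta.
  apply: (bounded_nondecr_cvg (B := 0)) => n.
    have [[C1 _] [C2' _]] := (Sn n, Sn n.+1); rewrite lerN2.
    apply: (intR_le (ltW L0) (C2_continuous C2') (C2_continuous C1)) => x xL.
    by have [] := dn n x xL.
  by rewrite oppr_le0; have /andP[] := setS_intR L0 (Sn n).
apply: (iter_limit (I := - I) Sn); first by case: hy.
  move=> n x xL; rewrite distrC [X in _ <= _ * X]distrC.
  exact: (cone_dist L0 (Sn n.+1) (Sn n) (dn n)).
move=> eta /hI[n0 h]; exists n0 => n /h.
by rewrite -opprD normrN opprK.
Qed.

(** The lower and upper iterations squeeze every other one, and [sol_unique] identifies their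
    limits. *)
Lemma iteration_converges : exists u,
  [/\ lin_sol L (a + b * intR 0 L u) c P u, setS L lam u
    & forall y0 y, setS L lam y0 -> iter_seq L a b c lam p y0 y ->
        unif_cvg_on L y u].
Proof.
have [S0 S1] := (setS_zero L0 (ltW lam0), setS_phi L0 (ltW lam0)).
have [al hal] := iter_seq_exists S0; have [be hbe] := iter_seq_exists S1.
have [u [hu Su au]] := iter_limit_zero hal.
have [v [hv Sv bv]] := iter_limit_phi hbe.
have u2 (x : R) : 0 <= x <= L -> d2 u x <= 0.
  by move=> xL; have /andP[] := setS_d2_ge Su xL.
have v2 (x : R) : 0 <= x <= L -> d2 v x <= 0.
  by move=> xL; have /andP[] := setS_d2_ge Sv xL.
have uv := sol_unique L0 a0 b0 c0 hu hv u2 v2.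
exists u; split; [exact: hu|exact: Su|] => y0 y Sy hy eps eps0.
have [c1 c2] := setS_cone Sy.
have ay := iter_seq_le S0 Sy c1 hal hy.
have yb := iter_seq_le Sy S1 c2 hy hbe.
have [n1 h1] := au eps eps0; have [n2 h2] := bv eps eps0.
exists (maxn n1 n2) => n; rewrite geq_max => /andP[nn1 nn2] x xL.
have := h1 n nn1 x xL; have := h2 n nn2 x xL; rewrite -(uv x xL).
have [l1 _] := ay n x xL; have [l2 _] := yb n x xL.
rewrite !ltr_norml => /andP[_ p2] /andP[p3 _]; apply/andP; split.
- by apply: lt_le_trans p3 _; rewrite lerD2r.
- by apply: le_lt_trans _ p2; rewrite lerD2r.
Qed.

Lemma sol_P_lin_sol (w : R -> R) :
  sol_P L a b c p w <-> lin_sol L (a + b * intR 0 L w) c P w.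
Proof.
apply: (W41_lin_sol _ _ w L0 p_int) => x xL.
rewrite (P_prim xL) P_prim ?lexx ?(ltW L0) //.
by rewrite [intR 0 0 p]/intR set_itv1 Rintegral_set1 subr0.
Qed.

(* An interior zero of a nonnegative concave function is a minimum, hence the
   function vanishes identically, and then so does the load. *)
Lemma sol_pos (u : R -> R) :
  ~ (\forall x \ae (@lebesgue_measure R), `[0, L]%classic x -> p x = 0) ->
  lin_sol L (a + b * intR 0 L u) c P u -> setS L lam u ->
  forall x : R, 0 < x < L -> 0 < u x.
Proof.
move=> pN0 [[h1 h2 h3] bc eu] [_ Su] x /andP[x0 xL]; rewrite lt_neqAle.
have xI : 0 <= x <= L by rewrite !ltW.
have [/andP[ux0 _] _] := Su x xI; rewrite ux0 andbT eq_sym.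
apply/negP => /eqP ux; apply: pN0.
have d1mono : forall s t : R, 0 <= s -> s <= t -> t <= L -> d1 u t <= d1 u s.
  by apply: (is_deriv_nonincr h2) => z /Su[_ /andP[]].
have uge (z : R) : 0 <= z <= L -> 0 <= u z by move=> /Su[/andP[]].
(* By the mean value theorem, [d1 u] is nonpositive somewhere left of the zero and nonnegative
   somewhere right of it; being nonincreasing, it vanishes at [x]. *)
have d1x : d1 u x = 0.
  apply/le_anti/andP; split.
  - have [s /andP[s0 sx] e] := is_deriv_MVT h1 x0.
    have : d1 u s <= 0.
      rewrite -(pmulr_lle0 _ (_ : 0 < x - 0)) ?subr0 // -[x in _ * x]subr0 -e.
      by rewrite ux sub0r oppr_le0 uge // lexx ltW.
    by apply: le_trans; apply: d1mono; exact: ltW.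
  - have [s /andP[s0 sx] e] := is_deriv_MVT h1 xL.
    have : 0 <= d1 u s.
      rewrite -(pmulr_lge0 _ (_ : 0 < L - x)) ?subr_gt0 // -e.
      by rewrite ux subr0 uge // lexx ltW.
    by move=> h; apply: le_trans h _; apply: d1mono; exact: ltW.
have u0 (z : R) : 0 <= z <= L -> u z = 0.
  move=> /andP[z0 zL]; apply/le_anti; rewrite uge ?z0 // andbT -ux.
  case: (leP z x) => [zx|/ltW xz].
  - apply: (is_deriv_nondecr h1 _ z0 zx (lexx x)) => s /andP[s0 sx].
    by rewrite -d1x; apply: d1mono => //; exact: ltW.
  - apply: (is_deriv_nonincr h1 _ (lexx x) xz zL) => s /andP[s0 sx].
    by rewrite -d1x; apply: d1mono => //; exact: ltW.
have d10 := is_deriv_zero L0 h1 u0.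
have d20 := is_deriv_zero L0 h2 d10.
have d30 := is_deriv_zero L0 h3 d20.
apply: (intR_eq0_ae p_int p_ge0).
have Iu : intR 0 L u = 0.
  apply/eqP; rewrite -normr_le0; have := intR_dist (ltW L0)
    (is_deriv_continuous h1) (is_deriv_continuous (@is_deriv_cst R 0)) (e := 0).
  rewrite (intR_cst0 (ltW L0)) subr0 mulr0; apply => z zL.
  by rewrite u0 // subrr normr0.
have LI : 0 <= L <= L by rewrite lexx ltW.
have OI : (0 : R) <= 0 <= L by rewrite lexx ltW.
(* With [u] and its derivatives zero on the interval, the integrated equation at [L] reduces to the
   vanishing of the integral of [p]. *)
have := eu L LI.
rewrite (d30 L LI) (d30 0 OI) (d10 L LI) (d10 0 OI) Iu subrr !mulr0 mul0r.
rewrite subr0 add0r (P_prim LI) (P_prim OI) [intR 0 0 p]/intR set_itv1.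
by rewrite Rintegral_set1 subr0 => <-.
Qed.
End Iteration.

Theorem theorem5p2 (R : realType) (L a b c lam : R) (p : R -> R) :
  0 < L -> 0 < a -> 0 < b -> 0 < c -> 0 < lam ->
  (@lebesgue_measure R).-integrable `[0, L] (EFin \o p) ->
  (\forall x \ae (@lebesgue_measure R), `[0, L]%classic x -> 0 <= p x) ->
  (\forall x \ae (@lebesgue_measure R), `[0, L]%classic x ->
     p x <= (lam * pi ^+ 4 / L ^+ 4 + a * lam * pi ^+ 2 / L ^+ 2
             + 2 * b * lam ^+ 2 * pi / L) * sin (pi / L * x)
            + 2 * lam * c * L / pi) ->
  c + b * lam * pi ^+ 2 / L ^+ 2 <=
    4 * (a + 2 * b * lam * L / pi) / L ^+ 3 *
      sigmaR (Num.sqrt (a + 2 * b * lam * L / pi) * L) ->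
  ~ (\forall x \ae (@lebesgue_measure R), `[0, L]%classic x -> p x = 0) ->
  lam * L ^+ 3 / 4 * (2 * b / pi + b * pi ^+ 2 / 4) <= 1 ->
  exists u : R -> R,
    [/\ sol_P L a b c p u, setS L lam u, (forall x, 0 < x < L -> 0 < u x),
        (forall v, sol_P L a b c p v -> setS L lam v ->
           (forall x, 0 < x < L -> 0 < v x) ->
           forall x, 0 <= x <= L -> v x = u x)
      & forall y0 : R -> R,
          y0 = (fun _ => 0) \/ y0 = phi L lam \/ setS L lam y0 ->
          (exists y, iter_seq L a b c lam p y0 y) /\
          (forall y, iter_seq L a b c lam p y0 y -> unif_cvg_on L y u)].
Proof.
move=> L0 a0 b0 c0 lam0 p_int p_ge0 p_ub N_ub pN0 _.
have [P [P_cont P_prim]] := L1_primitive (ltW L0) p_int.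
have [u [hu Su cvg]] :=
  iteration_converges L0 a0 b0 c0 lam0 p_int p_ge0 p_ub N_ub P_cont P_prim.
have solE := sol_P_lin_sol a b c L0 p_int P_prim.
exists u; split.
- exact/solE.
- exact: Su.
- exact: (sol_pos L0 p_int p_ge0 P_prim pN0 hu Su).
- move=> v /solE hv Sv _ x xL.
  have d2S w : setS L lam w -> forall z : R, 0 <= z <= L -> d2 w z <= 0.
    by move=> [_ Sw] z /Sw[_ /andP[]].
  exact: (sol_unique L0 a0 b0 c0 hv hu (d2S v Sv) (d2S u Su)).
- move=> y0 y0S; have S0 : setS L lam y0.
    case: y0S => [->|[->|//]]; first exact: setS_zero L0 (ltW lam0).
    exact: setS_phi L0 (ltW lam0).
  split; last by move=> y; exact: cvg.
  exact: (iter_seq_exists L0 a0 b0 c0 lam0 p_int p_ge0 p_ub N_ub P_cont P_prim).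
Qed.
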